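(* Let $N\ge 1$, let $G$ be an undirected graph with node set $\mathcal N=\{1,\dots,N\}$, and suppose $G$ is connected. Let the data $\mathbf Y,\mathbf R,\Omega$ (partitioned by rows across the $N$ nodes), the parameters $\lambda_*,\lambda_1\ge 0$, the inner dimension $\rho\ge 1$, the penalty coefficient $c>0$ and the step size $\mu>0$ be as in the context. Suppose that the sequence of iterates $\{\mathbf Q_n[k],\mathbf L_n[k],\mathbf A_n[k]\}_{n\in\mathcal N}$, $k=1,2,\dots$, generated by the distributed algorithm described in the context (from arbitrary initial $\mathbf L_n[1],\mathbf Q_n[1]$) converges, as $k\to\infty$, to $\{\bar{\mathbf Q}_n,\bar{\mathbf L}_n,\bar{\mathbf A}_n\}_{n\in\mathcal N}$. Then: (i) $\bar{\mathbf Q}_n=\bar{\mathbf Q}_m$ and $\bar{\mathbf A}_n=\bar{\mathbf A}_m$ for all $n,m\in\mathcal N$; (ii) with $\bar{\mathbf L}:=[\bar{\mathbf L}_1',\dots,\bar{\mathbf L}_N']'$, if $$\|\mathcal P_\Omega(\mathbf Y-\bar{\mathbf L}\bar{\mathbf Q}_1'-\mathbf R\bar{\mathbf A}_1)\|\le\lambda_*,$$ where $\|\cdot\|$ is the spectral norm, then $\hat{\mathbf X}=\bar{\mathbf L}\bar{\mathbf Q}_1'$ and $\hat{\mathbf A}=\bar{\mathbf A}_1$ form a globally optimal solution $\{\hat{\mathbf X},\hat{\mathbf A}\}$ of $$\text{(P1)}\qquad \min_{\mathbf X\in\mathbb R^{L\times T},\,\mathbf A\in\mathbb R^{F\times T}}\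 \tfrac12\|\mathcal P_\Omega(\mathbf Y-\mathbf X-\mathbf R\mathbf A)\|_F^2+\lambda_*\|\mathbf X\|_*+\lambda_1\|\mathbf A\|_1 .$$
   Context: Notation. $'$ denotes transpose, $\langle \mathbf M,\mathbf U\rangle=\mathrm{tr}(\mathbf M'\mathbf U)$, $\|\cdot\|_F$ is the Frobenius norm, $\|\cdot\|_*$ the nuclear norm (sum of singular values), $\|\mathbf A\|_1=\sum_{f,t}|a_{f,t}|$ the entrywise $\ell_1$-norm. Data. $L,T,F$ are positive integers, $\mathbf Y\in\mathbb R^{L\times T}$, $\mathbf R\in\mathbb R^{L\times F}$, and $\Omega\subseteq\{1,\dots,L\}\times\{1,\dots,T\}$. The sampling operator $\mathcal P_\Omega$ sets to zero the entries of its matrix argument with index not in $\Omega$ and leaves the others unchanged. The rows are partitioned across nodes: $L=\sum_{n=1}^N L_n$, $\mathbf Y=[\mathbf Y_1',\dots,\mathbf Y_N']'$ with $\mathbf Y_n\in\mathbb R^{L_n\times T}$, $\mathbf R=[\mathbf R_1',\dots,\mathbf R_N']'$ with $\mathbf R_n\in\mathbb R^{L_n\times F}$, and $\mathcal P_{\Omega_n}$ denotes the restriction of the sampling operator to the rows of node $n$ (so that $\mathcal P_\Omega$ applied to a stacked matrix is the stack of the $\mathcal P_{\Omega_n}$ applied to the blocks). The variables have sizes $\mathbf L_n\in\mathbb R^{L_n\times\rho}$, $\mathbf Q_n,\mathbf O_n\in\mathbb R^{T\times\rho}$, $\mathbf A_n,\mathbf B_n,\mathbf M_n,\mathbf P_n\in\mathbb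 R^{F\times T}$. Network. $\mathcal J_n$ is the set of neighbors of node $n$ in $G$ ($n\notin\mathcal J_n$, and $m\in\mathcal J_n$ iff $n\in\mathcal J_m$). Local residual: $r_n(\mathbf L_n,\mathbf Q_n,\mathbf B_n):=\frac12\|\mathcal P_{\Omega_n}(\mathbf Y_n-\mathbf L_n\mathbf Q_n'-\mathbf R_n\mathbf B_n)\|_F^2$. Soft-thresholding: $\mathcal S_\tau(\mathbf M)$ is the matrix with $(i,j)$ entry $\mathrm{sign}(m_{i,j})\max\{|m_{i,j}|-\tau,0\}$. Algorithm. Initialize, for every $n\in\mathcal N$, $\mathbf M_n[0]=\mathbf P_n[0]=\mathbf A_n[1]=\mathbf B_n[1]=\mathbf 0_{F\times T}$, $\mathbf O_n[0]=\mathbf 0_{T\times\rho}$, and $\mathbf L_n[1],\mathbf Q_n[1]$ arbitrarily. For $k=1,2,\dots$ every node $n\in\mathcal N$ performs (where $\arg\min$ denotes a minimizer): [S1] $\mathbf M_n[k]=\mathbf M_n[k-1]+\mu(\mathbf B_n[k]-\mathbf A_n[k])$; $\mathbf O_n[k]=\mathbf O_n[k-1]+\mu\sum_{m\in\mathcal J_n}(\mathbf Q_n[k]-\mathbf Q_m[k])$; $\mathbf P_n[k]=\mathbf P_n[k-1]+\mu\sum_{m\in\mathcal J_n}(\mathbf A_n[k]-\mathbf A_m[k])$. [S2] $\mathbf Q_n[k+1]=\arg\min_{\mathbf Q}\big\{r_n(\mathbf L_n[k],\mathbf Q,\mathbf B_n[k])+\frac{\lambda_*}{2N}\|\mathbf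 Q\|_F^2+\langle\mathbf O_n[k],\mathbf Q\rangle+c\sum_{m\in\mathcal J_n}\big\|\mathbf Q-\tfrac{\mathbf Q_n[k]+\mathbf Q_m[k]}{2}\big\|_F^2\big\}$; $\mathbf A_n[k+1]=[c(1+2|\mathcal J_n|)]^{-1}\,\mathcal S_{\lambda_1/N}\big(\mathbf M_n[k]+c\mathbf B_n[k]-\mathbf P_n[k]+c\sum_{m\in\mathcal J_n}(\mathbf A_n[k]+\mathbf A_m[k])\big)$. [S3] $\mathbf L_n[k+1]=\arg\min_{\mathbf L}\big\{r_n(\mathbf L,\mathbf Q_n[k+1],\mathbf B_n[k])+\frac{\lambda_*}{2}\|\mathbf L\|_F^2\big\}$. [S4] $\mathbf B_n[k+1]=\arg\min_{\mathbf B}\big\{r_n(\mathbf L_n[k+1],\mathbf Q_n[k+1],\mathbf B)+\langle\mathbf M_n[k],\mathbf B\rangle+\frac c2\|\mathbf B-\mathbf A_n[k+1]\|_F^2\big\}$. *)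

(* Defs.v *)
From HB Require Import structures.
From mathcomp Require Import all_boot all_order all_algebra.
From mathcomp Require Import spectral.
From mathcomp Require Import complex.
From mathcomp Require Import all_classical all_reals all_analysis.

Set Implicit Arguments.
Unset Strict Implicit.
Unset Printing Implicit Defensive.

Import Order.TTheory GRing.Theory Num.Theory.
Import numFieldNormedType.Exports.

Local Open Scope ring_scope.

Definition inner (R : realType) (m n : nat) (M U : 'M[R]_(m, n)) : R :=
  \tr (M^T *m U).

Definition frobenius_norm (R : realType) (m n : nat) (M : 'M[R]_(m, n)) : R :=
  Num.sqrt (\sum_i \sum_j M i j ^+ 2).

Definition l1_norm (R : realType) (m n : nat) (M : 'M[R]_(m, n)) : R :=
  \sum_i \sum_j `|M i j|.

(* Square roots of the eigenvalues, with multiplicity, of the symmetric matrix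
   M^T M. The library diagonalises over an algebraically closed field, hence the
   detour through R[i]. There are n of them: when m < n the list is padded
   with zeros, which changes neither the sum nor the maximum below. *)
Definition singular_values (R : realType) (m n : nat) (M : 'M[R]_(m, n)) :
    'rV[R]_n :=
  \row_j Num.sqrt (complex.Re
    (spectral_diag (map_mx (real_complex R) (M^T *m M)) 0 j)).

Lemma char_poly_singular_values (R : realType) (m n : nat) (M : 'M[R]_(m, n)) :
  char_poly (M^T *m M) = \prod_j ('X - (singular_values M 0 j ^+ 2)%:P).
Proof.
set A := map_mx (real_complex R) (M^T *m M).
have Ah : A \is hermsymmx.
  apply: realsym_hermsym.
    by apply/is_hermitianmxP; rewrite expr0 scale1r map_mx_id // /A map_trmx trmx_mul trmxK.
  by apply/mxOverP => i j; rewrite mxE; rewrite /= -/(real_complex R _) complex_real.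
have /orthomx_spectralP AE := hermitian_normalmx Ah.
set P := spectralmx A in AE; set d := spectral_diag A in AE.
have Pu : P \in unitmx := spectral_unit A.
have dge j : 0 <= d 0 j.
  have /(congr1 (fun X => P *m X *m invmx P)) := AE.
  rewrite !mulmxA mulmxV // mul1mx mulmxK // => /matrixP/(_ j j).
  rewrite [in RHS]mxE eqxx mulr1n => <-.
  rewrite invmx_unitary ?spectral_unitarymx // /A map_mxM mulmxA -mulmxA.
  set V := map_mx _ M *m _.
  have -> : P *m map_mx (real_complex R) M^T = map_mx Num.conj V^T.
    rewrite /V trmx_mul map_mxM; congr (_ *m _).
      by apply/matrixP => a b; rewrite !mxE; exact/esym/conjCK.
    by apply/matrixP => a b; rewrite !mxE; apply/esym/CrealP; rewrite complex_real.
  rewrite mxE; apply: sumr_ge0 => k _; rewrite !mxE mulrC; exact: mul_conjC_ge0.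
apply: (@map_poly_inj _ _ (real_complex R)).
rewrite map_char_poly -/A rmorph_prod /=.
rewrite (_ : char_poly A = char_poly (diag_mx d)); last first.
  rewrite [in LHS]AE /char_poly /char_poly_mx !map_mxM /=.
  have e : map_mx polyC (invmx P) *m map_mx polyC P = 1%:M.
    by rewrite -map_mxM mulVmx // map_mx1.
  have -> : 'X%:M - map_mx polyC (invmx P) *m map_mx polyC (diag_mx d) *m map_mx polyC P =
     map_mx polyC (invmx P) *m ('X%:M - map_mx polyC (diag_mx d)) *m map_mx polyC P.
    by rewrite mulmxBr mulmxBl scalar_mxC -mulmxA -[X in _ = X - _]mulmxA e mulmx1.
  by rewrite !det_mulmx mulrAC -det_mulmx e det1 mul1r.
rewrite char_poly_trig ?diag_mx_is_trig //; apply: eq_bigr => j _.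
rewrite rmorphB /= map_polyX map_polyC /= !mxE eqxx mulr1n -/A -/d.
congr ('X - _%:P).
rewrite sqr_sqrtr; last by move: (dge j); rewrite lecE /= => /andP[].
move: (dge j); rewrite lecE /= => /andP[/eqP e _].
by case: (d 0 j) e => a b /= ->.
Qed.

Definition nuclear_norm (R : realType) (m n : nat) (M : 'M[R]_(m, n)) : R :=
  \sum_j singular_values M 0 j.

Definition spectral_norm (R : realType) (m n : nat) (M : 'M[R]_(m, n)) : R :=
  \big[Num.max/0]_j singular_values M 0 j.

Definition sampling (R : realType) (m n : nat) (Omega : {set 'I_m * 'I_n})
    (M : 'M[R]_(m, n)) : 'M[R]_(m, n) :=
  \matrix_(i, j) (if (i, j) \in Omega then M i j else 0).

Definition soft_threshold (R : realType) (m n : nat) (tau : R)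
    (M : 'M[R]_(m, n)) : 'M[R]_(m, n) :=
  \matrix_(i, j) (Num.sg (M i j) * Num.max (`|M i j| - tau) 0).

Definition is_minimizer (R : realType) (V : Type) (f : V -> R) (x : V) : Prop :=
  forall y, f x <= f y.

Definition neighbors (N : nat) (adj : rel 'I_N) (n : 'I_N) : {set 'I_N} :=
  [set m | adj n m].

(* [tagnat.Rank n i] is the position, in the stacked matrix, of row i of block n;
   it is the indexing used by [submxcol] and [\mxcol]. *)
Definition local_samples (N : nat) (ell : 'I_N -> nat) (T : nat)
    (Omega : {set 'I_(\sum_(n < N) ell n) * 'I_T}) (n : 'I_N) :
    {set 'I_(ell n) * 'I_T} :=
  [set p | (tagnat.Rank n p.1, p.2) \in Omega].

Lemma sampling_mxcol (R : realType) (N : nat) (ell : 'I_N -> nat) (T : nat)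
    (Omega : {set 'I_(\sum_(n < N) ell n) * 'I_T})
    (M : forall n : 'I_N, 'M[R]_(ell n, T)) :
  sampling Omega (\mxcol_n M n) =
  \mxcol_n sampling (local_samples Omega n) (M n).
Proof.
apply/mxcolP => n; rewrite mxcolK; apply/matrixP => i j.
have := mxcolK M n => /matrixP/(_ i j); rewrite /submxcol !mxE => ->.
by rewrite inE.
Qed.

Definition local_residual (R : realType) (N : nat) (ell : 'I_N -> nat)
    (T F rho : nat)
    (Y : 'M[R]_(\sum_(n < N) ell n, T)) (Reg : 'M[R]_(\sum_(n < N) ell n, F))
    (Omega : {set 'I_(\sum_(n < N) ell n) * 'I_T}) (n : 'I_N)
    (L : 'M[R]_(ell n, rho)) (Q : 'M[R]_(T, rho)) (B : 'M[R]_(F, T)) : R :=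
  2^-1 * frobenius_norm (sampling (local_samples Omega n)
           (submxcol Y n - L *m Q^T - submxcol Reg n *m B)) ^+ 2.

(* Sequences are indexed by the iteration number k; M, O, P start at k = 0 and
   A, B, Q, L at k = 1 (the values A 0, B 0, Q 0, L 0 are never used). *)
Record is_distributed_run (R : realType) (N : nat) (ell : 'I_N -> nat)
    (T F rho : nat) (adj : rel 'I_N)
    (Y : 'M[R]_(\sum_(n < N) ell n, T)) (Reg : 'M[R]_(\sum_(n < N) ell n, F))
    (Omega : {set 'I_(\sum_(n < N) ell n) * 'I_T})
    (lambda_star lambda_1 c mu : R)
    (M P A B : nat -> 'I_N -> 'M[R]_(F, T))
    (O Q : nat -> 'I_N -> 'M[R]_(T, rho))
    (L : nat -> forall n : 'I_N, 'M[R]_(ell n, rho)) : Prop :=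
  IsDistributedRun {
  run_M0 : forall n, M 0%N n = 0;
  run_P0 : forall n, P 0%N n = 0;
  run_A1 : forall n, A 1%N n = 0;
  run_B1 : forall n, B 1%N n = 0;
  run_O0 : forall n, O 0%N n = 0;
  run_M : forall k n, (1 <= k)%N ->
    M k n = M k.-1 n + mu *: (B k n - A k n);
  run_O : forall k n, (1 <= k)%N ->
    O k n = O k.-1 n + mu *: (\sum_(m in neighbors adj n) (Q k n - Q k m));
  run_P : forall k n, (1 <= k)%N ->
    P k n = P k.-1 n + mu *: (\sum_(m in neighbors adj n) (A k n - A k m));
  run_Q : forall k n, (1 <= k)%N ->
    is_minimizer (fun X : 'M[R]_(T, rho) =>
        local_residual Y Reg Omega (L k n) X (B k n)
        + lambda_star / (2 * N%:R) * frobenius_norm X ^+ 2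
        + inner (O k n) X
        + c * \sum_(m in neighbors adj n)
                frobenius_norm (X - 2^-1 *: (Q k n + Q k m)) ^+ 2)
      (Q k.+1 n);
  run_A : forall k n, (1 <= k)%N ->
    A k.+1 n = (c * (1 + 2 * #|neighbors adj n|%:R))^-1 *:
      soft_threshold (lambda_1 / N%:R)
        (M k n + c *: B k n - P k n
         + c *: \sum_(m in neighbors adj n) (A k n + A k m));
  run_L : forall k n, (1 <= k)%N ->
    is_minimizer (fun X : 'M[R]_(ell n, rho) =>
        local_residual Y Reg Omega X (Q k.+1 n) (B k n)
        + lambda_star / 2 * frobenius_norm X ^+ 2)
      (L k.+1 n);
  run_B : forall k n, (1 <= k)%N ->
    is_minimizer (fun X : 'M[R]_(F, T) =>
        local_residual Y Reg Omega (L k.+1 n) (Q k.+1 n) X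
        + inner (M k n) X
        + c / 2 * frobenius_norm (X - A k.+1 n) ^+ 2)
      (B k.+1 n)
}.

Definition P1_objective (R : realType) (Lr T F : nat) (Y : 'M[R]_(Lr, T))
    (Reg : 'M[R]_(Lr, F)) (Omega : {set 'I_Lr * 'I_T})
    (lambda_star lambda_1 : R)
    (XA : 'M[R]_(Lr, T) * 'M[R]_(F, T)) : R :=
  2^-1 * frobenius_norm (sampling Omega (Y - XA.1 - Reg *m XA.2)) ^+ 2
  + lambda_star * nuclear_norm XA.1 + lambda_1 * l1_norm XA.2.

(* Main.v *)
(** Only Q, L and A are assumed to converge: with a large step size the splitting
    error E = B - A and the multipliers may oscillate forever. They are however
    bounded. With H = R_n' P_n R_n, the stationarity of B reads
    H E[k+1] + M[k] + c E[k+1] = O(1), while soft-thresholding forces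
    M[k] + c E[k] - P[k] = O(1) because A converges. Eliminating M, the sequence
    (mu - H) E differs from P by O(1) and satisfies a recursion that bounds it by
    its own increments; hence P, E, M and then O are bounded. The increments of a
    bounded sequence have Cesaro mean 0, so the limits of the increments of P and O
    (the graph Laplacian applied to the limits of A and Q) vanish, which is
    consensus, and E has Cesaro mean 0 as well.

    Cesaro means of the optimality conditions, summed over the nodes (where O and P
    cancel), then yield, with S the limiting sampled residual, S'L = lambda_* Q,
    S Q = lambda_* L, and R'S is a subgradient of lambda_1 |.|_1 at A. Since
    <S, LQ'> = lambda_* (|L|^2 + |Q|^2) / 2 >= lambda_* |LQ'|_*, while
    <S, X> <= lambda_* |X|_* for every X when |S| <= lambda_*, convexity makes
    (LQ', A) optimal. *)

Require Import Defs.
From HB Require Import structures.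
From mathcomp Require Import all_boot all_order all_algebra.
From mathcomp Require Import spectral.
From mathcomp Require Import complex.
From mathcomp Require Import all_classical all_reals all_analysis.
From mathcomp Require Import ring lra.

Set Implicit Arguments.
Unset Strict Implicit.
Unset Printing Implicit Defensive.

Import Order.TTheory GRing.Theory Num.Theory.
Import numFieldNormedType.Exports.

Local Open Scope classical_set_scope.
Local Open Scope ring_scope.

Lemma mxtrace_mulBB (K : pzRingType) m n (A B : 'M[K]_(m, n)) (G H : 'M[K]_(n, m)) :
  \tr ((A - B) *m (G - H)) =
  \tr (A *m G) - \tr (A *m H) - (\tr (B *m G) - \tr (B *m H)).
Proof. by rewrite mulmxBl !mulmxBr !raddfB. Qed.

(** * Singular value decomposition and the duality of spectral and nuclear norms *)

Section SingularValues.
Local Open Scope sesquilinear_scope.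
Variable R : realType.
Local Notation C := R[i].
Local Notation toC := (map_mx (real_complex R)).

Lemma adjmxM m n p (X : 'M[C]_(m, n)) (Z : 'M[C]_(n, p)) :
  (X *m Z)^t* = Z^t* *m X^t*.
Proof. by rewrite trmx_mul map_mxM. Qed.

Lemma adjmxB m n (X Z : 'M[C]_(m, n)) : (X - Z)^t* = X^t* - Z^t*.
Proof. by rewrite linearB map_mxB. Qed.

Lemma adj_toC m n (M : 'M[R]_(m, n)) : (toC M)^t* = toC M^T.
Proof.
apply/matrixP => i j; rewrite !mxE; apply/CrealP.
by rewrite -/(real_complex R _) complex_real.
Qed.

Lemma adj_diag_toC n (d : 'rV[R]_n) : (diag_mx (toC d))^t* = diag_mx (toC d).
Proof. by rewrite -map_diag_mx adj_toC tr_diag_mx. Qed.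

Lemma diag_adjmx_ge0 m n (X : 'M[C]_(m, n)) j : 0 <= (X^t* *m X) j j.
Proof.
by rewrite mxE; apply: sumr_ge0 => i _; rewrite !mxE mulrC mul_conjC_ge0.
Qed.

Lemma tr_adjmx_ge0 m n (X : 'M[C]_(m, n)) : 0 <= \tr (X^t* *m X).
Proof. by apply: sumr_ge0 => j _; exact: diag_adjmx_ge0. Qed.

Lemma singular_values_ge0 m n (M : 'M[R]_(m, n)) j : 0 <= singular_values M 0 j.
Proof. by rewrite mxE sqrtr_ge0. Qed.

(** The eigenvalues are the diagonal of the Gram matrix of [M P^*], hence real and nonnegative, so
    taking real parts and square roots in [singular_values] loses nothing. *)
Lemma gram_spectral m n (M : 'M[R]_(m, n)) :
  exists2 P : 'M[C]_n, P \is unitarymx &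
    P *m (toC M)^t* *m toC M *m P^t* =
    diag_mx (toC (\row_j singular_values M 0 j ^+ 2)).
Proof.
pose G := toC (M^T *m M).
have Gh : G \is hermsymmx.
  apply/is_hermitianmxP; rewrite expr0 scale1r -[RHS]/(G^t*) adj_toC.
  by rewrite trmx_mul trmxK.
have /orthomx_spectralP GE := hermitian_normalmx Gh.
pose P := spectralmx G; pose d := spectral_diag G.
have Pu : P \is unitarymx := spectral_unitarymx G.
exists P => //.
have PG : P *m (toC M)^t* *m toC M *m P^t* = diag_mx d.
  rewrite adj_toC -[P *m _ *m _]mulmxA -map_mxM -/G GE invmx_unitary //.
  by rewrite !mulmxA (unitarymxP Pu) mul1mx mulmxtVK.
rewrite PG; congr diag_mx; apply/rowP => j; rewrite !mxE -/G -/d.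
have dj : 0 <= d 0 j.
  have := diag_adjmx_ge0 (toC M *m P^t*) j.
  by rewrite adjmxM trmxCK mulmxA PG mxE eqxx mulr1n.
have [dRe dIm] : 0 <= complex.Re (d 0 j) /\ complex.Im (d 0 j) = 0.
  by move: dj; rewrite lecE /= => /andP[/eqP].
by rewrite sqr_sqrtr //; case: (d 0 j) dIm => a b /= ->.
Qed.

(** [U] consists of the columns of [M P^*] divided by their norms, null columns staying null. It has
    the shape of [M] and is only a partial isometry: [U^* U] is the projection onto the indices of
    nonzero singular values. *)
Lemma svd m n (M : 'M[R]_(m, n)) :
  exists (U : 'M[C]_(m, n)) (P : 'M[C]_n),
  [/\ P \is unitarymx, toC M = U *m diag_mx (toC (singular_values M)) *m P,
      U *m U^t* *m U = U &
      U^t* *m U = diag_mx (toC (\row_j (singular_values M 0 j != 0)%:R))].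
Proof.
have [P Pu PG] := gram_spectral M.
move: (singular_values M) PG => s PG.
have [W WE] : exists W, W = toC M *m P^t* by eexists.
have WW : W^t* *m W = diag_mx (toC (\row_j s 0 j ^+ 2)).
  by rewrite WE adjmxM trmxCK mulmxA PG.
pose D := diag_mx (toC s).
(* Since the inverse of 0 is 0, [D'] is the pseudo-inverse of [D]. *)
pose D' := diag_mx (toC (\row_j (s 0 j)^-1)).
pose U := W *m D'.
have UU : U^t* *m U = diag_mx (toC (\row_j (s 0 j != 0)%:R)).
  rewrite /U adjmxM adj_diag_toC !mulmxA -[_ *m _ *m W]mulmxA WW !mulmx_diag.
  congr diag_mx; apply/rowP => j; rewrite !mxE -!rmorphM /=; congr (_%:C)%C.
    have [->|s0] := eqVneq (s 0 j) 0; first by rewrite invr0 !mul0r.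
  by rewrite expr2 mulrA mulVf // mul1r divff.
have WU : W = U *m D.
  rewrite -mulmxA mulmx_diag; apply/matrixP => i j.
  rewrite mul_mx_diag !mxE -rmorphM /=.
  have [s0|s0] := eqVneq (s 0 j) 0; last by rewrite mulVf // mulr1.
  (* When [s 0 j] is 0, column [j] of [W] has squared norm 0 and therefore vanishes. *)
  have /eqP : (W^t* *m W) j j = 0 by rewrite WW !mxE eqxx s0 expr0n.
  rewrite mxE psumr_eq0; last first.
    by move=> k _; rewrite !mxE mulrC mul_conjC_ge0.
  move=> /allP/(_ i); rewrite mem_index_enum => /(_ isT) /=.
  by rewrite !mxE mulrC mul_conjC_eq0 => /eqP ->; rewrite mul0r.
exists U, P; split => //.
  by rewrite -WU WE mulmxKtV.
rewrite -mulmxA UU /U -mulmxA mulmx_diag; congr (_ *m diag_mx _).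
apply/rowP => j; rewrite !mxE -rmorphM /=; congr (_%:C)%C.
by have [->|_] := eqVneq (s 0 j) 0; rewrite ?invr0 ?mul0r ?mulr1.
Qed.

(* The three terms are [2 Re <G, H>], [|G|^2] and [|H|^2]. *)
Lemma tr_adjmx_le m n (G H : 'M[C]_(m, n)) :
  \tr (G^t* *m H) + \tr (H^t* *m G) <= \tr (G^t* *m G) + \tr (H^t* *m H).
Proof.
have := tr_adjmx_ge0 (G - H).
rewrite adjmxB mxtrace_mulBB => h; rewrite -subr_ge0 (le_trans h) // le_eqVlt.
move: (\tr (G^t* *m G)) (\tr (G^t* *m H)) (\tr (H^t* *m G)) (\tr (H^t* *m H)).
by move=> gg gh hg hh; apply/orP; left; apply/eqP; ring.
Qed.

(** With [L Q^T = U D P], the nuclear norm is [<G, H>] for [G = L^* U] and [H = (P Q)^*]. Then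
    [2 Re <G, H>] is at most [|G|^2 + |H|^2], where [|H| = |Q|] because [P] is unitary and
    [|G| <= |L|] because [U U^*] is an orthogonal projection. *)
Lemma nuclear_norm_mul_le m n p (L : 'M[R]_(m, p)) (Q : 'M[R]_(n, p)) :
  2 * nuclear_norm (L *m Q^T) <= \tr (L^T *m L) + \tr (Q^T *m Q).
Proof.
have [U [P [Pu UP UUU UU]]] := svd (L *m Q^T).
rewrite /nuclear_norm; move: (singular_values _) UP UU => s UP UU.
have Ptu : P^t* *m P = 1%:M.
  by have := Pu; rewrite -trmxC_unitary => /unitarymxP; rewrite trmxCK.
pose G := (toC L)^t* *m U; pose H := (P *m toC Q)^t*.
have nE : \tr (G^t* *m H) = (\sum_j s 0 j)%:C%C.
  rewrite adjmxM trmxCK /H adjmxM -mulmxA (mulmxA (toC L)) adj_toC -map_mxM.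
  rewrite UP !mulmxA UU mulmxtVK // mulmx_diag /mxtrace rmorph_sum.
  apply: eq_bigr => j _; rewrite !mxE eqxx mulr1n -rmorphM /=.
  have [->|_] := eqVneq (s 0 j) 0; by rewrite ?mulr0 ?mul1r.
have nE' : \tr (H^t* *m G) = (\sum_j s 0 j)%:C%C.
  rewrite -[H^t* *m G]trmxCK adjmxM trmxCK trace_map_mx mxtrace_tr nE.
  by apply/CrealP; rewrite complex_real.
have HE : \tr (H^t* *m H) = (\tr (Q^T *m Q))%:C%C.
  rewrite /H trmxCK mxtrace_mulC adjmxM mulmxA -(mulmxA _ (P^t*)) Ptu mulmx1.
  by rewrite adj_toC -map_mxM trace_map_mx.
have GE : \tr (G^t* *m G) <= (\tr (L^T *m L))%:C%C.
  have [E EU] : exists E, E = U *m U^t* by eexists.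
  have Eh : E^t* = E by rewrite EU adjmxM trmxCK.
  have EE : E *m E = E by rewrite EU mulmxA UUU.
  rewrite /G adjmxM trmxCK mxtrace_mulC mulmxA -(mulmxA _ U (U^t*)) -EU.
  have := tr_adjmx_ge0 (toC L - E *m toC L).
  rewrite adjmxB adjmxM Eh mxtrace_mulBB (mulmxA _ E) (mulmxA (_ *m E)).
  rewrite -(mulmxA _ E E) EE [X in _ - X]subrr subr0.
  by rewrite subr_ge0 [in X in _ <= X]adj_toC -map_mxM trace_map_mx.
have := tr_adjmx_le G H; rewrite nE nE' HE => h.
have {h} := le_trans h (lerD GE (lexx _)).
by rewrite -!rmorphD lecR /= mulrDl !mul1r.
Qed.

Lemma singular_values_le_spectral_norm m n (M : 'M[R]_(m, n)) j :
  singular_values M 0 j <= spectral_norm M.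
Proof. exact: le_bigmax. Qed.

Lemma spectral_norm_ge0 m n (M : 'M[R]_(m, n)) : 0 <= spectral_norm M.
Proof. exact: bigmax_ge_id. Qed.

(** In an eigenbasis of the Gram matrix, the entry is a convex combination of squared singular
    values: the weights are the squared moduli of a column of the unitary matrix [T]. *)
Lemma diag_gram_le m n (M : 'M[R]_(m, n)) (P : 'M[C]_n) j :
  P \is unitarymx ->
  (P *m (toC M)^t* *m toC M *m P^t*) j j <= (spectral_norm M ^+ 2)%:C%C.
Proof.
move=> Pu; have [V Vu VE] := gram_spectral M.
have sE k : singular_values M 0 k ^+ 2 <= spectral_norm M ^+ 2.
  by rewrite ler_sqr ?nnegrE ?singular_values_ge0 ?spectral_norm_ge0 //
    singular_values_le_spectral_norm.
move: (singular_values M) (spectral_norm M) sE VE => s t sE VE.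
have Vtu : V^t* *m V = 1%:M.
  by have := Vu; rewrite -trmxC_unitary => /unitarymxP; rewrite trmxCK.
have [T TE] : exists T, T = V *m P^t* by eexists.
have -> : P *m (toC M)^t* *m toC M *m P^t* =
    T^t* *m diag_mx (toC (\row_j s 0 j ^+ 2)) *m T.
  rewrite -VE TE adjmxM trmxCK !mulmxA -(mulmxA _ (V^t*) V) Vtu mulmx1.
  by rewrite -(mulmxA _ (V^t*) V) Vtu mulmx1.
have T1 : (T^t* *m T) j j = 1.
  rewrite TE adjmxM trmxCK mulmxA -(mulmxA _ (V^t*) V) Vtu mulmx1.
  by rewrite (unitarymxP Pu) mxE eqxx.
rewrite -[leRHS]mulr1 -T1 !mxE mulr_sumr; apply: ler_sum => k _.
rewrite mul_mx_diag !mxE mulrAC [leRHS]mulrC ler_wpM2l //.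
  by rewrite mulrC mul_conjC_ge0.
by rewrite lecR.
Qed.

(** With [X = U D P] and [Z = S P^*], the inner product is the sum of the [s_j Re (Z^* U)_jj]. Each
    factor is at most [lambda] by Cauchy-Schwarz, since column [j] of [Z] has norm at most [lambda]
    and that of [U] at most 1. *)
Lemma inner_le_nuclear_norm m n (S X : 'M[R]_(m, n)) (lambda : R) :
  spectral_norm S <= lambda -> inner S X <= lambda * nuclear_norm X.
Proof.
move=> Sl; have l0 : 0 <= lambda := le_trans (spectral_norm_ge0 S) Sl.
have [U [P [Pu XE _ UU]]] := svd X.
have := singular_values_ge0 X; rewrite /nuclear_norm.
move: (singular_values X) XE UU => s XE UU s0.
have [Z ZE] : exists Z, Z = toC S *m P^t* by eexists.
have ZZ j : (Z^t* *m Z) j j <= (lambda ^+ 2)%:C%C.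
  rewrite ZE adjmxM trmxCK mulmxA; apply: (le_trans (diag_gram_le S j Pu)).
  by rewrite lecR ler_sqr ?nnegrE ?spectral_norm_ge0.
have UU1 j : (U^t* *m U) j j <= 1.
  rewrite UU !mxE eqxx mulr1n; case: (s 0 j != 0); last by rewrite ler01.
  by rewrite lexx.
(* Cauchy-Schwarz from [|z - t u|^2 >= 0] for the columns [z], [u]. The natural choice [t = lambda]
   may be 0, so [t] is raised by [e / 2] to allow the division by [t]. *)
have cross j : 2 * complex.Re ((Z^t* *m U) j j) <= 2 * lambda.
  apply/ler_addgt0Pr => e e0.
  have t0 : 0 < lambda + e / 2 by rewrite ltr_wpDl // divr_gt0.
  set t := lambda + e / 2 in t0 *.
  have := diag_adjmx_ge0 (Z - t%:C%C *: U) j.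
  have UZ : (U^t* *m Z) j j = ((Z^t* *m U) j j)^*.
    by rewrite -[U^t* *m Z]trmxCK adjmxM trmxCK !mxE.
  have adjU : (Z - t%:C%C *: U)^t* = Z^t* - t%:C%C *: U^t*.
    rewrite adjmxB linearZ /= map_mxZ; congr (_ - _ *: _).
    by apply/CrealP; rewrite complex_real.
  rewrite adjU mulmxBl !mulmxBr -!scalemxAl -!scalemxAr.
  move: (Z^t* *m Z) (Z^t* *m U) (U^t* *m Z) (U^t* *m U) (ZZ j) (UU1 j) UZ.
  move=> a b b' d aj dj b'E; rewrite !mxE b'E.
  move: (a j j) (b j j) (d j j) aj dj => [x1 y1] [x2 y2] [x3 y3].
  rewrite !lecE /=; simpc => /andP[_ h1] /andP[_ h3] /andP[_ h].
  have h4 : t * (2 * x2) <= t * (2 * lambda + e).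
    have := ler_wpM2l (sqr_ge0 t) h3.
    have : lambda ^+ 2 <= t ^+ 2 by rewrite ler_sqr ?nnegrE // /t; lra.
    rewrite (_ : 2 * lambda + e = 2 * t); last by rewrite /t; field.
    lra.
  by rewrite ler_pM2l in h4.
have -> : inner S X = \sum_j s 0 j * complex.Re ((Z^t* *m U) j j).
  have : (inner S X)%:C%C = \tr (Z^t* *m U *m diag_mx (toC s)).
    rewrite ZE adjmxM trmxCK -!mulmxA mxtrace_mulC -mulmxA -mulmxA.
    by rewrite (mulmxA U) -XE adj_toC -map_mxM trace_map_mx.
  move/(congr1 (@complex.Re _)) => /= ->; rewrite /mxtrace raddf_sum /=.
  apply: eq_bigr => j _; rewrite mul_mx_diag [LHS]/= mxE.
  move: ((Z^t* *m U) j j) => [x y]; rewrite !mxE; simpc.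
  by rewrite mulrC.
rewrite mulr_sumr; apply: ler_sum => j _.
have := cross j; rewrite ler_pM2l // => /(ler_wpM2l (s0 j)).
by rewrite [s 0 j * lambda]mulrC.
Qed.
End SingularValues.

(** * Inner products, stationarity of quadratic functions, and an optimality certificate *)

Section Optimality.
Variable R : realType.

Lemma innerE m n (M U : 'M[R]_(m, n)) : inner M U = \sum_i \sum_j M i j * U i j.
Proof.
rewrite /inner /mxtrace exchange_big /=; apply: eq_bigr => j _.
by rewrite mxE; apply: eq_bigr => i _; rewrite mxE.
Qed.

Lemma innerC m n (M U : 'M[R]_(m, n)) : inner M U = inner U M.
Proof. by rewrite /inner -mxtrace_tr trmx_mul trmxK. Qed.

Lemma innerDr m n (M U V : 'M[R]_(m, n)) :
  inner M (U + V) = inner M U + inner M V.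
Proof. by rewrite /inner mulmxDr raddfD. Qed.

Lemma innerBr m n (M U V : 'M[R]_(m, n)) :
  inner M (U - V) = inner M U - inner M V.
Proof. by rewrite /inner mulmxBr raddfB. Qed.

Lemma innerZr m n t (M U : 'M[R]_(m, n)) : inner M (t *: U) = t * inner M U.
Proof. by rewrite /inner -scalemxAr mxtraceZ. Qed.

Lemma innerDl m n (M U V : 'M[R]_(m, n)) :
  inner (M + U) V = inner M V + inner U V.
Proof. by rewrite innerC innerDr !(innerC V). Qed.

Lemma innerBl m n (M U V : 'M[R]_(m, n)) :
  inner (M - U) V = inner M V - inner U V.
Proof. by rewrite innerC innerBr !(innerC V). Qed.

Lemma innerZl m n t (M U : 'M[R]_(m, n)) : inner (t *: M) U = t * inner M U.
Proof. by rewrite innerC innerZr innerC. Qed.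

Lemma inner0l m n (U : 'M[R]_(m, n)) : inner 0 U = 0.
Proof. by rewrite -(scale0r U) innerZl mul0r. Qed.

Lemma inner_suml (I : finType) (r : pred I) m n (M : I -> 'M[R]_(m, n)) U :
  inner (\sum_(i | r i) M i) U = \sum_(i | r i) inner (M i) U.
Proof.
by apply: (big_morph (fun M => inner M U)) => [A B|]; rewrite ?innerDl ?inner0l.
Qed.

Lemma inner_mulmxr m n p (S : 'M[R]_(m, n)) (A : 'M[R]_(m, p)) (D : 'M[R]_(p, n)) :
  inner S (A *m D) = inner (A^T *m S) D.
Proof. by rewrite /inner trmx_mul trmxK mulmxA. Qed.

Lemma inner_mulmxl m n p (S : 'M[R]_(m, n)) (A : 'M[R]_(p, n)) (D : 'M[R]_(m, p)) :
  inner S (D *m A) = inner (S *m A^T) D.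
Proof. by rewrite /inner trmx_mul trmxK mulmxA mxtrace_mulC mulmxA. Qed.

Lemma inner_tr m n (M U : 'M[R]_(m, n)) : inner M^T U^T = inner M U.
Proof.
rewrite !innerE exchange_big; apply: eq_bigr => i _; apply: eq_bigr => j _.
by rewrite !mxE.
Qed.

Lemma inner_mulmx_tr m n p (S : 'M[R]_(m, n)) (L : 'M[R]_(m, p)) (D : 'M[R]_(n, p)) :
  inner S (L *m D^T) = inner (S^T *m L) D.
Proof.
by rewrite inner_mulmxr -[RHS]inner_tr trmx_mul trmxK.
Qed.

Lemma frobenius_norm_sqr m n (M : 'M[R]_(m, n)) :
  frobenius_norm M ^+ 2 = inner M M.
Proof.
rewrite /frobenius_norm sqr_sqrtr ?innerE //.
by apply: sumr_ge0 => i _; apply: sumr_ge0 => j _; rewrite sqr_ge0.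
Qed.

Lemma inner_ge0 m n (M : 'M[R]_(m, n)) : 0 <= inner M M.
Proof. by rewrite -frobenius_norm_sqr sqr_ge0. Qed.

Lemma inner_eq0 m n (M : 'M[R]_(m, n)) : inner M M = 0 -> M = 0.
Proof.
rewrite innerE => /eqP; rewrite psumr_eq0 => [/allP h|i _]; last first.
  by apply: sumr_ge0 => j _; rewrite -expr2 sqr_ge0.
apply/matrixP => i j; move: (h i); rewrite mem_index_enum => /(_ isT) /=.
rewrite psumr_eq0 => [/allP/(_ j)|k _]; last by rewrite -expr2 sqr_ge0.
by rewrite mem_index_enum => /(_ isT) /=; rewrite mulf_eq0 orbb mxE => /eqP.
Qed.

Lemma sqr_norm_expand m n (X D : 'M[R]_(m, n)) t :
  frobenius_norm (X + t *: D) ^+ 2 =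
  frobenius_norm X ^+ 2 + t * (2 * inner X D) + t ^+ 2 * frobenius_norm D ^+ 2.
Proof.
rewrite !frobenius_norm_sqr innerDl !innerDr !innerZl !innerZr (innerC D X).
by ring.
Qed.

Lemma samplingD m n Omega (X Z : 'M[R]_(m, n)) :
  sampling Omega (X + Z) = sampling Omega X + sampling Omega Z.
Proof. by apply/matrixP => i j; rewrite !mxE; case: ifP; rewrite ?addr0. Qed.

Lemma samplingZ m n Omega t (X : 'M[R]_(m, n)) :
  sampling Omega (t *: X) = t *: sampling Omega X.
Proof. by apply/matrixP => i j; rewrite !mxE; case: ifP; rewrite ?mulr0. Qed.

Lemma samplingB m n Omega (X Z : 'M[R]_(m, n)) :
  sampling Omega (X - Z) = sampling Omega X - sampling Omega Z.
Proof. by rewrite -scaleN1r samplingD samplingZ scaleN1r. Qed.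

Lemma inner_sampling m n Omega (X Z : 'M[R]_(m, n)) :
  inner (sampling Omega X) (sampling Omega Z) = inner (sampling Omega X) Z.
Proof.
rewrite !innerE; apply: eq_bigr => i _; apply: eq_bigr => j _.
by rewrite !mxE; case: ifP; rewrite ?mul0r.
Qed.

Lemma half_sqr_sampling_expand m n Omega (Z D : 'M[R]_(m, n)) t :
  2^-1 * frobenius_norm (sampling Omega (Z - t *: D)) ^+ 2 =
  2^-1 * frobenius_norm (sampling Omega Z) ^+ 2
  - t * inner (sampling Omega Z) D
  + t ^+ 2 * (2^-1 * frobenius_norm (sampling Omega D) ^+ 2).
Proof.
rewrite samplingB samplingZ -scaleNr sqr_norm_expand inner_sampling sqrrN.
by field.
Qed.

(** For quadratic [f] it is enough to expand along the gradient [G] itself. With [a = |G|^2] and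
    [b = |q| + 1 > q], the step [t = - a / b] changes [f] by [(a / b)^2 (q - b)], which is negative
    unless [a] is 0. *)
Lemma minimizer_stationary m n (f : 'M[R]_(m, n) -> R) X G q :
  is_minimizer f X ->
  (forall t, f (X + t *: G) = f X + t * inner G G + t ^+ 2 * q) -> G = 0.
Proof.
move=> fX fE; apply: inner_eq0; apply/eqP; rewrite eq_le inner_ge0 andbT.
rewrite leNgt; apply/negP; set a := inner G G in fE * => a0.
have b0 : 0 < `|q| + 1 by rewrite ltr_wpDl.
set b := `|q| + 1 in b0.
have qb : q < b by rewrite (le_lt_trans (ler_norm q)) // ltrDl.
have := fX (X - (a / b) *: G); rewrite -scaleNr fE -addrA lerDl sqrrN.
rewrite (_ : _ + _ = (a / b) ^+ 2 * (q - b)); last by field; rewrite gt_eqF.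
by rewrite pmulr_rge0 ?exprn_gt0 ?divr_gt0 // subr_ge0 leNgt qb.
Qed.

(** The equations for [S^T L] and [S Q] are the stationarity conditions of the factored problem,
    where half of [|L|^2 + |Q|^2] replaces the nuclear norm. Together with the spectral bound they
    make [S] a subgradient of the nuclear term at [L Q^T]. *)
Lemma P1_certificate m T F p (Y : 'M[R]_(m, T)) (Reg : 'M[R]_(m, F)) Omega
    (lambda_star lambda_1 : R) (L : 'M[R]_(m, p)) (Q : 'M[R]_(T, p))
    (A : 'M[R]_(F, T)) :
  let S := sampling Omega (Y - L *m Q^T - Reg *m A) in
  0 <= lambda_star -> spectral_norm S <= lambda_star ->
  S^T *m L = lambda_star *: Q -> S *m Q = lambda_star *: L ->
  (forall Z, inner (Reg^T *m S) (Z - A) <= lambda_1 * (l1_norm Z - l1_norm A)) ->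
  is_minimizer (P1_objective Y Reg Omega lambda_star lambda_1) (L *m Q^T, A).
Proof.
move=> S ls0 Sl SL SQ SA [X Z]; rewrite /P1_objective /= -/S.
have hX := inner_le_nuclear_norm X Sl.
have h1 : lambda_star * nuclear_norm (L *m Q^T) <= inner S (L *m Q^T).
  have := nuclear_norm_mul_le L Q; rewrite -/(inner L L) -/(inner Q Q).
  move/(ler_wpM2l ls0); rewrite mulrDr -!innerZl -SL -SQ.
  rewrite -inner_mulmx_tr -[Q in S *m Q]trmxK -inner_mulmxl.
  by move=> h; lra.
have := SA Z; rewrite -inner_mulmxr mulmxBr innerBr => h2.
have -> : Y - X - Reg *m Z =
    Y - L *m Q^T - Reg *m A - 1 *: ((X - L *m Q^T) + (Reg *m Z - Reg *m A)).
  by apply/matrixP => i j; rewrite !mxE; ring.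
rewrite half_sqr_sampling_expand -/S innerDr !innerBr.
set d := frobenius_norm (sampling Omega (_ + _)).
have := sqr_ge0 d; lra.
Qed.

End Optimality.

(** * Bounded real sequences and Cesaro means *)

Section Sequences.
Variable R : realType.
Implicit Types (u v : R^nat) (a b : R).

Definition bounded_seq u := exists C, forall k, `|u k| <= C.

Definition mean_to u a := arithmetic_mean u @ \oo --> a.

Lemma bounded_seqD u v :
  bounded_seq u -> bounded_seq v -> bounded_seq (fun k => u k + v k).
Proof.
move=> [C hu] [D hv]; exists (C + D) => k.
by rewrite (le_trans (ler_normD _ _)) // lerD.
Qed.

Lemma bounded_seqM u v :
  bounded_seq u -> bounded_seq v -> bounded_seq (fun k => u k * v k).
Proof.
by move=> [C hu] [D hv]; exists (C * D) => k; rewrite normrM ler_pM.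
Qed.

Lemma bounded_seq_cst a : bounded_seq (fun=> a).
Proof. by exists `|a|. Qed.

Lemma bounded_seq_sum (I : finType) (r : pred I) (u : I -> R^nat) :
  (forall i, r i -> bounded_seq (u i)) ->
  bounded_seq (fun k => \sum_(i | r i) u i k).
Proof.
move=> h; elim: (index_enum I) => [|i s IH].
  by under eq_fun do rewrite big_nil; exact: bounded_seq_cst.
under eq_fun do rewrite big_cons; case: (boolP (r i)) => // /h hi; exact: bounded_seqD.
Qed.

Lemma bounded_seq_shift u : bounded_seq (fun k => u k.+1) -> bounded_seq u.
Proof.
move=> [C hC]; exists (Num.max `|u 0%N| C) => -[|k]; rewrite le_max ?lexx //.
by rewrite hC orbT.
Qed.

Lemma cvg_bounded_seq u a : u @ \oo --> a -> bounded_seq u.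
Proof.
move=> /cvgP/cvg_seq_bounded [M [_ hM]]; exists (M + 1) => k.
by apply: hM => //; rewrite ltrDl.
Qed.

(** The constant [D] is chosen so that [b D + C <= a D]; the bound by [D] then propagates from [k]
    to [k.+1]. *)
Lemma bounded_seq_contraction u a b : 0 <= b < a ->
  bounded_seq (fun k => a * u k.+1 - b * u k) -> bounded_seq u.
Proof.
move=> /andP[b0 ba] [C hC]; have ab0 : 0 < a - b by rewrite subr_gt0.
exists (Num.max `|u 0%N| (C / (a - b))); elim=> [|k IH].
  by rewrite le_max lexx.
set D := Num.max _ _ in IH *.
have CD : C <= (a - b) * D by rewrite mulrC -ler_pdivrMr // le_max lexx orbT.
have a0 : 0 < a by rewrite (le_lt_trans b0).
rewrite -(ler_pM2l a0) -{1}(gtr0_norm a0) -normrM.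
rewrite -[a * u k.+1](subrK (b * u k)) (le_trans (ler_normD _ _)) //.
rewrite normrM (ger0_norm b0); have := ler_wpM2l b0 IH; have := hC k; lra.
Qed.

Lemma mean_toE u : arithmetic_mean u = (fun n => n.+1%:R^-1 * \sum_(k < n.+1) u k).
Proof. by apply/funext => n; rewrite /arithmetic_mean /= /series /= big_mkord. Qed.

Lemma mean_toD u v a b :
  mean_to u a -> mean_to v b -> mean_to (fun k => u k + v k) (a + b).
Proof.
rewrite /mean_to !mean_toE => hu hv.
under eq_fun do rewrite big_split mulrDr; exact: cvgD.
Qed.

Lemma mean_toZ c u a : mean_to u a -> mean_to (fun k => c * u k) (c * a).
Proof.
rewrite /mean_to !mean_toE => hu.
under eq_fun do rewrite -mulr_sumr mulrCA; exact: cvgM (cvg_cst c) hu.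
Qed.

Lemma mean_toN u a : mean_to u a -> mean_to (fun k => - u k) (- a).
Proof.
move=> /(mean_toZ (c := -1)); rewrite mulN1r; congr mean_to.
by apply/funext => k; rewrite mulN1r.
Qed.

Lemma mean_to_cvg u a : u @ \oo --> a -> mean_to u a.
Proof. exact: cesaro. Qed.

Lemma mean_to_cst a : mean_to (fun=> a) a.
Proof. by apply: mean_to_cvg; exact: cvg_cst. Qed.

Lemma mean_to_sum (I : finType) (r : pred I) (u : I -> R^nat) (a : I -> R) :
  (forall i, r i -> mean_to (u i) (a i)) ->
  mean_to (fun k => \sum_(i | r i) u i k) (\sum_(i | r i) a i).
Proof.
move=> h; elim: (index_enum I) => [|i s IH].
  by under eq_fun do rewrite big_nil; rewrite big_nil; exact: mean_to_cst.
under eq_fun do rewrite big_cons; rewrite big_cons; case: (boolP (r i)) => // /h hi.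
exact: mean_toD.
Qed.

Lemma cvg_seq_sum (I : finType) (r : pred I) (u : I -> R^nat) (a : I -> R) :
  (forall i, r i -> u i @ \oo --> a i) ->
  (fun k => \sum_(i | r i) u i k) @ \oo --> \sum_(i | r i) a i.
Proof.
move=> h; elim: (index_enum I) => [|i s IH].
  by under eq_fun do rewrite big_nil; rewrite big_nil; exact: cvg_cst.
under eq_fun do rewrite big_cons; rewrite big_cons; case: (boolP (r i)) => // /h hi.
exact: cvgD.
Qed.

Lemma mean_to_unique u a b : mean_to u a -> mean_to u b -> a = b.
Proof. by move=> /cvg_lim <- // /cvg_lim <-. Qed.

Lemma cvg_bounded_mul0 u v : bounded_seq u -> v @ \oo --> (0 : R) ->
  (fun k => u k * v k) @ \oo --> (0 : R).
Proof.
move=> [C hC] v0; apply/norm_cvg0P.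
have hCv : (fun k => C * `|v k|) @ \oo --> (0 : R).
  by rewrite -(mulr0 C); apply: cvgM (cvg_cst C) _; rewrite -(normr0 R); exact: cvg_norm.
apply: squeeze_cvgr (cvg_cst 0) hCv; apply: nearW => k.
by rewrite normr_ge0 normrM ler_wpM2r.
Qed.

(** Cesaro means are not multiplicative, but here [u (v - b)] tends to 0 and what is left, [b u], is
    linear in [u]. *)
Lemma mean_toM_cvg u v a b : bounded_seq u -> mean_to u a ->
  v @ \oo --> b -> mean_to (fun k => u k * v k) (a * b).
Proof.
move=> ub ua vb; have : (fun k => v k - b) @ \oo --> (0 : R).
  by rewrite -(subrr b); apply: cvgB vb (cvg_cst _).
move=> /(cvg_bounded_mul0 ub)/mean_to_cvg/(mean_toD (mean_toZ (c := b) ua)).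
rewrite addr0 mulrC; congr mean_to; apply/funext => k; by rewrite mulrBr mulrC; ring.
Qed.

(** The partial sums telescope, so the average is a bounded quantity divided by [n.+1]. *)
Lemma mean_to_increments u :
  bounded_seq u -> mean_to (fun k => u k.+1 - u k) 0.
Proof.
move=> [C hC]; rewrite /mean_to mean_toE.
under eq_fun do rewrite -(big_mkord xpredT (fun k => u k.+1 - u k)) telescope_sumr // mulrC.
apply: cvg_bounded_mul0; last exact: cvg_harmonic.
exists (C + C) => k; rewrite (le_trans (ler_normB _ _)) //.
by rewrite lerD.
Qed.

Lemma mean_to_le0 u a : mean_to u a -> (forall k, u k <= 0) -> a <= 0.
Proof.
rewrite /mean_to mean_toE => ua u0.
have <- := cvg_lim (@Rhausdorff R) ua; apply: limr_le; first by apply/cvg_ex; exists a.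
apply: nearW => n; rewrite mulr_ge0_le0 ?invr_ge0 // -oppr_ge0 -sumrN.
by apply: sumr_ge0 => k _; rewrite oppr_ge0.
Qed.

End Sequences.

(** * Entrywise boundedness, convergence and Cesaro means of matrix sequences *)

Section MatrixSequences.
Variable R : realType.

Definition bounded_mx m n (X : nat -> 'M[R]_(m, n)) :=
  forall i j, bounded_seq (fun k => X k i j).

Definition cvg_mx m n (X : nat -> 'M[R]_(m, n)) (x : 'M[R]_(m, n)) :=
  forall i j, (fun k => X k i j) @ \oo --> x i j.

Definition mean_mx m n (X : nat -> 'M[R]_(m, n)) (x : 'M[R]_(m, n)) :=
  forall i j, mean_to (fun k => X k i j) (x i j).

Lemma cvg_to_cvg_mx m n (X : nat -> 'M[R]_(m, n)) x : X @ \oo --> x -> cvg_mx X x.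
Proof.
move=> Xx i j; exact: (cvg_comp _ _ Xx (@coord_continuous _ _ _ i j x)).
Qed.

Section Bounded.
Variables m n : nat.
Implicit Types X Z : nat -> 'M[R]_(m, n).

Lemma bounded_mxD X Z :
  bounded_mx X -> bounded_mx Z -> bounded_mx (fun k => X k + Z k).
Proof.
by move=> hX hZ i j; under eq_fun do rewrite mxE; exact: bounded_seqD.
Qed.

Lemma bounded_mxZ a X : bounded_mx X -> bounded_mx (fun k => a *: X k).
Proof.
move=> hX i j; under eq_fun do rewrite mxE.
by apply: bounded_seqM => //; exact: bounded_seq_cst.
Qed.

Lemma bounded_mxB X Z :
  bounded_mx X -> bounded_mx Z -> bounded_mx (fun k => X k - Z k).
Proof.
have -> : (fun k => X k - Z k) = (fun k => X k + (-1) *: Z k).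
  by apply/funext => k; rewrite scaleN1r.
move=> hX hZ.
exact: bounded_mxD hX (bounded_mxZ (-1) hZ).
Qed.

Lemma bounded_mx_sum (I : finType) (r : pred I) (X : I -> nat -> 'M[R]_(m, n)) :
  (forall i, r i -> bounded_mx (X i)) ->
  bounded_mx (fun k => \sum_(i | r i) X i k).
Proof.
move=> h i j; under eq_fun do rewrite summxE.
by apply: bounded_seq_sum => l rl; exact: h.
Qed.

Lemma bounded_mx_shift X : bounded_mx (fun k => X k.+1) -> bounded_mx X.
Proof. by move=> h i j; apply: bounded_seq_shift; exact: h. Qed.

Lemma bounded_mx_behead X : bounded_mx X -> bounded_mx (fun k => X k.+1).
Proof. by move=> h i j; have [C hC] := h i j; exists C. Qed.

Lemma bounded_mx_sampling Om X :
  bounded_mx X -> bounded_mx (fun k => sampling Om (X k)).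
Proof.
move=> h i j; under eq_fun do rewrite mxE.
case: ((i, j) \in Om) => //; exact: bounded_seq_cst.
Qed.

Lemma cvg_bounded_mx X x : cvg_mx X x -> bounded_mx X.
Proof. by move=> h i j; apply: cvg_bounded_seq; exact: h. Qed.

End Bounded.

Lemma bounded_mx_cst m n (x : 'M[R]_(m, n)) : bounded_mx (fun=> x).
Proof. by move=> i j; exact: bounded_seq_cst. Qed.

Lemma bounded_mx_tr m n (X : nat -> 'M[R]_(m, n)) :
  bounded_mx X -> bounded_mx (fun k => (X k)^T).
Proof. by move=> h i j; under eq_fun do rewrite mxE; exact: h. Qed.

Lemma bounded_mxM m n p (X : nat -> 'M[R]_(m, n)) (Z : nat -> 'M[R]_(n, p)) :
  bounded_mx X -> bounded_mx Z -> bounded_mx (fun k => X k *m Z k).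
Proof.
move=> hX hZ i j; under eq_fun do rewrite mxE.
by apply: bounded_seq_sum => l _; exact: bounded_seqM.
Qed.

Section Converging.
Variables m n : nat.
Implicit Types (X Z : nat -> 'M[R]_(m, n)) (x z : 'M[R]_(m, n)).

Lemma cvg_mx_cst x : cvg_mx (fun=> x) x.
Proof. by move=> i j; exact: cvg_cst. Qed.

Lemma cvg_mx_shift X x : cvg_mx X x -> cvg_mx (fun k => X k.+1) x.
Proof.
by move=> h i j; move: (h i j); rewrite -(cvg_shiftS (fun k => X k i j)).
Qed.

Lemma cvg_mxD X Z x z :
  cvg_mx X x -> cvg_mx Z z -> cvg_mx (fun k => X k + Z k) (x + z).
Proof.
by move=> hX hZ i j; under eq_fun do rewrite mxE; rewrite mxE; exact: cvgD.
Qed.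

Lemma cvg_mxZ a X x : cvg_mx X x -> cvg_mx (fun k => a *: X k) (a *: x).
Proof.
move=> hX i j; under eq_fun do rewrite mxE.
by rewrite mxE; apply: cvgM => //; exact: cvg_cst.
Qed.

Lemma cvg_mxB X Z x z :
  cvg_mx X x -> cvg_mx Z z -> cvg_mx (fun k => X k - Z k) (x - z).
Proof.
have -> : (fun k => X k - Z k) = (fun k => X k + (-1) *: Z k).
  by apply/funext => k; rewrite scaleN1r.
move=> hX hZ; rewrite -[- z]scaleN1r.
exact: cvg_mxD hX (cvg_mxZ hZ).
Qed.

Lemma cvg_mx_sum (I : finType) (r : pred I) (X : I -> nat -> 'M[R]_(m, n))
    (x : I -> 'M[R]_(m, n)) :
  (forall i, r i -> cvg_mx (X i) (x i)) ->
  cvg_mx (fun k => \sum_(i | r i) X i k) (\sum_(i | r i) x i).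
Proof.
move=> h i j; under eq_fun do rewrite summxE; rewrite summxE.
by apply: cvg_seq_sum => l rl; exact: h.
Qed.

Lemma cvg_mx_tr X x : cvg_mx X x -> cvg_mx (fun k => (X k)^T) x^T.
Proof. by move=> h i j; under eq_fun do rewrite mxE; rewrite mxE; exact: h. Qed.

Lemma mean_mx_cvg X x : cvg_mx X x -> mean_mx X x.
Proof. by move=> h i j; apply: mean_to_cvg; exact: h. Qed.

Lemma mean_mxD X Z x z :
  mean_mx X x -> mean_mx Z z -> mean_mx (fun k => X k + Z k) (x + z).
Proof.
by move=> hX hZ i j; under eq_fun do rewrite mxE; rewrite mxE; exact: mean_toD.
Qed.

Lemma mean_mxZ a X x : mean_mx X x -> mean_mx (fun k => a *: X k) (a *: x).
Proof.
by move=> hX i j; under eq_fun do rewrite mxE; rewrite mxE; exact: mean_toZ.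
Qed.

Lemma mean_mxB X Z x z :
  mean_mx X x -> mean_mx Z z -> mean_mx (fun k => X k - Z k) (x - z).
Proof.
have -> : (fun k => X k - Z k) = (fun k => X k + (-1) *: Z k).
  by apply/funext => k; rewrite scaleN1r.
move=> hX hZ; rewrite -[- z]scaleN1r.
exact: mean_mxD hX (mean_mxZ hZ).
Qed.

Lemma mean_mx_sum (I : finType) (r : pred I) (X : I -> nat -> 'M[R]_(m, n))
    (x : I -> 'M[R]_(m, n)) :
  (forall i, r i -> mean_mx (X i) (x i)) ->
  mean_mx (fun k => \sum_(i | r i) X i k) (\sum_(i | r i) x i).
Proof.
move=> h i j; under eq_fun do rewrite summxE; rewrite summxE.
by apply: mean_to_sum => l rl; exact: h.
Qed.

Lemma mean_mx_sampling Om X x :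
  mean_mx X x -> mean_mx (fun k => sampling Om (X k)) (sampling Om x).
Proof.
move=> h i j; under eq_fun do rewrite mxE; rewrite mxE.
by case: ((i, j) \in Om); [exact: h | exact: mean_to_cst].
Qed.

Lemma mean_mx_tr X x : mean_mx X x -> mean_mx (fun k => (X k)^T) x^T.
Proof. by move=> h i j; under eq_fun do rewrite mxE; rewrite mxE; exact: h. Qed.

Lemma mean_mx_unique X x z : mean_mx X x -> mean_mx X z -> x = z.
Proof. by move=> hx hz; apply/matrixP => i j; exact: mean_to_unique (hx i j) (hz i j). Qed.

Lemma mean_mx_increments X :
  bounded_mx X -> mean_mx (fun k => X k.+1 - X k) 0.
Proof.
move=> h i j; under eq_fun do rewrite !mxE; rewrite mxE.
exact: (mean_to_increments (h i j)).
Qed.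

End Converging.

Lemma cvg_mxM m n p (X : nat -> 'M[R]_(m, n)) (Z : nat -> 'M[R]_(n, p)) x z :
  cvg_mx X x -> cvg_mx Z z -> cvg_mx (fun k => X k *m Z k) (x *m z).
Proof.
move=> hX hZ i j; under eq_fun do rewrite mxE; rewrite mxE.
by apply: cvg_seq_sum => l _; exact: cvgM.
Qed.

Lemma mean_mxM m n p (X : nat -> 'M[R]_(m, n)) (Z : nat -> 'M[R]_(n, p)) x z :
  bounded_mx X -> mean_mx X x -> cvg_mx Z z ->
  mean_mx (fun k => X k *m Z k) (x *m z).
Proof.
move=> bX hX hZ i j; under eq_fun do rewrite mxE; rewrite mxE.
by apply: mean_to_sum => l _; exact: mean_toM_cvg.
Qed.

Lemma mean_mx_mull m n p (A : 'M[R]_(m, n)) (X : nat -> 'M[R]_(n, p)) x :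
  mean_mx X x -> mean_mx (fun k => A *m X k) (A *m x).
Proof.
move=> hX i j; under eq_fun do rewrite mxE; rewrite mxE.
by apply: mean_to_sum => l _; exact: mean_toZ.
Qed.

Lemma mean_inner m n (X Z : nat -> 'M[R]_(m, n)) x z :
  bounded_mx X -> mean_mx X x -> cvg_mx Z z ->
  mean_to (fun k => inner (X k) (Z k)) (inner x z).
Proof.
move=> bX hX hZ; under eq_fun do rewrite innerE; rewrite innerE.
apply: mean_to_sum => i _; apply: mean_to_sum => j _; exact: mean_toM_cvg.
Qed.

(** Meant for the subgradients of individual nodes, which are known to be bounded but whose means
    are computed only after summation over the network. *)
Lemma mean_inner0 m n (X Z : nat -> 'M[R]_(m, n)) :
  bounded_mx X -> cvg_mx Z 0 -> mean_to (fun k => inner (X k) (Z k)) 0.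
Proof.
move=> bX hZ; under eq_fun do rewrite innerE.
pose z := \sum_(i < m) \sum_(j < n) (0 : R).
have z0 : z = 0 by rewrite /z big1 // => i _; rewrite big1.
suff : mean_to (fun k => \sum_i \sum_j X k i j * Z k i j) z by rewrite z0.
apply: mean_to_sum => i _; apply: mean_to_sum => j _; apply: mean_to_cvg.
by apply: cvg_bounded_mul0 => //; move: (hZ i j); rewrite mxE.
Qed.

Lemma mean_l1_norm m n (X : nat -> 'M[R]_(m, n)) x :
  cvg_mx X x -> mean_to (fun k => l1_norm (X k)) (l1_norm x).
Proof.
move=> hX; apply: mean_to_sum => i _; apply: mean_to_sum => j _.
by apply: mean_to_cvg; apply: cvg_norm; exact: hX.
Qed.

(** * Boundedness of the multipliers and of the splitting error at one node *)

Section MultiplierBound.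
Variables (m n : nat) (H : 'M[R]_(m, n) -> 'M[R]_(m, n)) (c mu : R).
Hypotheses (HD : {morph H : X Z / X + Z}) (HZ : forall a, {morph H : X / a *: X}).
Hypothesis Hbounded : forall X, bounded_mx X -> bounded_mx (fun k => H (X k)).
Hypotheses (c0 : 0 < c) (mu0 : 0 < mu).
Variables E M P G U : nat -> 'M[R]_(m, n).
Hypotheses (bG : bounded_mx G) (bU : bounded_mx U).
Hypothesis bdP : bounded_mx (fun k => P k.+1 - P k).
Hypothesis statE : forall k, H (E k.+1) + M k + c *: E k.+1 = G k.
Hypothesis stepM : forall k, M k.+1 = M k + mu *: E k.+1.
Hypothesis MEPU : forall k, M k + c *: E k - P k = U k.

Let HN : {morph H : Z / - Z}.
Proof. by move=> Z; rewrite -scaleN1r HZ scaleN1r. Qed.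

Let X k := mu *: E k.+1 - H (E k.+1).

(** Subtracting [statE] at [k] from [MEPU] at [k.+1] leaves only the increment of [M], which is
    [mu *: E k.+1]. Increments of [X] are thus bounded along with those of [P]. *)
Let XE k : X k = P k.+1 + U k.+1 - G k.
Proof.
rewrite /X -MEPU -statE stepM; apply/matrixP => i j; rewrite !mxE; ring.
Qed.

Let dG k : G k.+1 - G k =
  H (E k.+2) + c *: E k.+2 - H (E k.+1) - c *: E k.+1 + mu *: E k.+1.
Proof. by rewrite -!statE stepM; apply/matrixP => i j; rewrite !mxE; ring. Qed.

Let bdG : bounded_mx (fun k => G k.+1 - G k).
Proof. by apply: bounded_mxB => //; exact: bounded_mx_behead. Qed.

Let bdX : bounded_mx (fun k => X k.+1 - X k).
Proof.
have -> : (fun k => X k.+1 - X k) =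
    (fun k => P k.+2 - P k.+1 + (U k.+2 - U k.+1) - (G k.+1 - G k)).
  by apply/funext => k; rewrite !XE; apply/matrixP => i j; rewrite !mxE; ring.
apply: bounded_mxB => //; apply: bounded_mxD; first exact: (bounded_mx_behead bdP).
apply: bounded_mxB; last exact: bounded_mx_behead.
exact: bounded_mx_behead (bounded_mx_behead bU).
Qed.

(* Applying [mu - H] to [dG] gives [(H + c) (X k.+1 - X k) + mu X k] bounded, and
   [X k.+1 - X k] is bounded, so [X] is. Adding the increments of [X] to [dG]
   cancels [H] and leaves the contraction [(c + mu) E k.+2 - c E k.+1]. *)
Lemma multiplier_bound : [/\ bounded_mx P, bounded_mx E & bounded_mx M].
Proof.
have bX : bounded_mx X.
  have -> : X = fun k => mu^-1 *: (mu *: (G k.+1 - G k) - H (G k.+1 - G k)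
      - H (X k.+1 - X k) - c *: (X k.+1 - X k)).
    apply/funext => k; rewrite dG /X.
    rewrite -[LHS](scalerK (lt0r_neq0 mu0)); congr (_ *: _).
    rewrite !(HD, HN, HZ); apply/matrixP => i j; rewrite !mxE; ring.
  apply: bounded_mxZ; apply: bounded_mxB; last exact: bounded_mxZ.
  apply: bounded_mxB; last exact: Hbounded.
  by apply: bounded_mxB; [exact: bounded_mxZ | exact: Hbounded].
have bE : bounded_mx E.
  apply: bounded_mx_shift => i j.
  apply: (@bounded_seq_contraction _ _ (c + mu) c); first by rewrite ltW ?ltrDl.
  have := bounded_mxD bdG bdX i j; congr bounded_seq; apply/funext => k.
  by rewrite dG /X !mxE; ring.
have bE1 := bounded_mx_behead bE; have bU1 := bounded_mx_behead bU.
split => //.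
  apply: bounded_mx_shift; have -> : (fun k => P k.+1) = (fun k => X k + G k - U k.+1).
    by apply/funext => k; rewrite XE; apply/matrixP => i j; rewrite !mxE; ring.
  by apply: bounded_mxB => //; exact: bounded_mxD.
have -> : M = (fun k => G k - H (E k.+1) - c *: E k.+1).
  by apply/funext => k; rewrite -statE; apply/matrixP => i j; rewrite !mxE; ring.
by apply: bounded_mxB; [apply: bounded_mxB => //; exact: Hbounded | exact: bounded_mxZ].
Qed.
End MultiplierBound.
End MatrixSequences.

(** * Sums over edges and the graph Laplacian *)

Section Network.
Variables (N : nat) (adj : rel 'I_N).
Hypothesis adj_sym : symmetric adj.

Lemma exchange_neighbors (V : zmodType) (x : 'I_N -> 'I_N -> V) :
  \sum_n \sum_(m in neighbors adj n) x n m =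
  \sum_n \sum_(m in neighbors adj n) x m n.
Proof.
rewrite (exchange_big_dep xpredT) //=; apply: eq_bigr => n _.
by apply: eq_bigl => m; rewrite !inE adj_sym.
Qed.

(** Each edge contributes two opposite terms. This keeps the network sums of the multipliers [O] and
    [P] constant along the run. *)
Lemma sum_neighbors_sub (V : zmodType) (x : 'I_N -> V) :
  \sum_n \sum_(m in neighbors adj n) (x n - x m) = 0.
Proof.
under eq_bigr do rewrite big_split /= sumrN.
rewrite big_split /= sumrN; apply/eqP; rewrite subr_eq0; apply/eqP.
exact: exchange_neighbors.
Qed.

(** The kernel of the Laplacian of a connected graph is the constants: pairing [L x = 0] with [x]
    makes the sum of squared differences over edges vanish, and equality spreads along paths. *)
Lemma consensus (R : realDomainType) (x : 'I_N -> R) :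
  (forall n m, connect adj n m) ->
  (forall n, \sum_(m in neighbors adj n) (x n - x m) = 0) ->
  forall n m, x n = x m.
Proof.
move=> adj_conn x0.
have : \sum_n \sum_(m in neighbors adj n) (x n - x m) ^+ 2 = 0.
  have h1 : \sum_n \sum_(m in neighbors adj n) x n * (x n - x m) = 0.
    by rewrite big1 // => n _; rewrite -mulr_sumr x0 mulr0.
  have h2 : \sum_n \sum_(m in neighbors adj n) x m * (x m - x n) = 0.
    by rewrite -exchange_neighbors.
  transitivity (\sum_n \sum_(m in neighbors adj n) x n * (x n - x m)
      + \sum_n \sum_(m in neighbors adj n) x m * (x m - x n)); last first.
    by rewrite h1 h2 addr0.
  rewrite -big_split /=; apply: eq_bigr => n _.
  by rewrite -big_split /=; apply: eq_bigr => m _ /=; ring.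
move=> /eqP; rewrite psumr_eq0 => [/allP h|n _]; last first.
  by apply: sumr_ge0 => m _; rewrite sqr_ge0.
have adjE n m : adj n m -> x n = x m.
  move: (h n); rewrite mem_index_enum => /(_ isT).
  rewrite psumr_eq0 => [/allP/(_ m)|k _]; last by rewrite sqr_ge0.
  rewrite mem_index_enum inE => /(_ isT) /implyP nm /nm.
  by rewrite sqrf_eq0 subr_eq0 => /eqP.
move=> n m; have /connectP[s] := adj_conn n m.
elim: s n => [|l s IH] n /=; first by move=> _ ->.
by move=> /andP[/adjE -> ls] /(IH _ ls).
Qed.
End Network.

(** * Soft-thresholding and the optimality conditions of the local updates *)

Section NormalEquations.
Variable R : realType.

Section SoftThreshold.
Variables (tau : R) (tau0 : 0 <= tau).
Local Notation soft v := (Num.sg v * Num.max (`|v| - tau) 0).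

Lemma normr_le_soft (v : R) : `|v| <= tau + `|soft v|.
Proof.
have [->|v0] := eqVneq v 0; first by rewrite normr0 sgr0 mul0r normr0 addr0.
rewrite normrM normr_sg v0 mul1r -lerBlDl.
by rewrite (le_trans _ (ler_norm _)) // le_max lexx.
Qed.

(* [v - kappa * a] is a subgradient of [tau * |.|] at [a]. *)
Lemma soft_subgradient (kappa v a z : R) : 0 < kappa -> kappa * a = soft v ->
  (v - kappa * a) * (z - a) <= tau * (`|z| - `|a|).
Proof.
move=> k0 ka; set w := v - kappa * a.
(* These two facts characterise subgradients of the scaled absolute value. Below the threshold [a]
   is 0 and [w] is [v]; above it [w] is [tau] times the sign of [v]. *)
have [wt wa] : `|w| <= tau /\ w * a = tau * `|a|.
  have [vt|vt] := leP `|v| tau.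
    have a0 : a = 0.
      apply: (mulfI (lt0r_neq0 k0)); rewrite ka mulr0 max_r ?mulr0 //.
      by rewrite subr_le0.
    by rewrite /w a0 normr0 !mulr0 subr0.
  have v0 : v != 0 by rewrite -normr_gt0 (le_lt_trans tau0).
  have ka' : kappa * a = Num.sg v * (`|v| - tau).
    by rewrite ka max_l // subr_ge0 ltW.
  have wE : w = Num.sg v * tau by rewrite /w ka' mulrBr -numEsg; ring.
  split; first by rewrite wE normrM normr_sg v0 mul1r ger0_norm.
  apply: (mulfI (lt0r_neq0 k0)); rewrite wE mulrCA ka'.
  rewrite [RHS]mulrCA -{1}(gtr0_norm k0) -normrM ka' normrM normr_sg v0 mul1r.
  rewrite (gtr0_norm (_ : 0 < `|v| - tau)) ?subr_gt0 // mulrAC mulrA.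
  by rewrite -expr2 sqr_sg v0 mul1r mulrC.
rewrite !mulrBr wa lerD2r (le_trans (ler_norm _)) // normrM.
by rewrite ler_wpM2r.
Qed.
End SoftThreshold.

Lemma soft_threshold_subgradient m n (tau kappa : R) (V A Z : 'M[R]_(m, n)) :
  0 <= tau -> 0 < kappa -> A = kappa^-1 *: soft_threshold tau V ->
  inner (V - kappa *: A) (Z - A) <= tau * (l1_norm Z - l1_norm A).
Proof.
move=> t0 k0 AE; rewrite innerE mulrBr !mulr_sumr -sumrB; apply: ler_sum => i _.
rewrite !mulr_sumr -sumrB; apply: ler_sum => j _; rewrite -mulrBr.
have := @soft_subgradient tau t0 kappa (V i j) (A i j) (Z i j) k0.
by rewrite !mxE; apply; rewrite AE !mxE mulVKf // lt0r_neq0.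
Qed.

(** Thresholding shrinks an entry by at most [tau], so bounded outputs force bounded inputs. *)
Lemma bounded_mx_soft_threshold m n (tau kappa : R) (V A : nat -> 'M[R]_(m, n)) :
  0 <= tau -> 0 < kappa -> (forall k, A k = kappa^-1 *: soft_threshold tau (V k)) ->
  bounded_mx A -> bounded_mx V.
Proof.
move=> t0 k0 AE bA i j; have [C hC] := bA i j.
exists (tau + kappa * C) => k; apply: le_trans (normr_le_soft t0 _) _; rewrite lerD2l.
have := hC k; rewrite AE !mxE normrM gtr0_norm ?invr_gt0 //.
by rewrite ler_pdivrMl.
Qed.

Variables (N : nat) (ell : 'I_N -> nat) (T F rho : nat).
Variables (Y : 'M[R]_(\sum_(n < N) ell n, T)) (Reg : 'M[R]_(\sum_(n < N) ell n, F)).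
Variable Omega : {set 'I_(\sum_(n < N) ell n) * 'I_T}.

Definition residual n (L : 'M[R]_(ell n, rho)) (Q : 'M[R]_(T, rho))
    (B : 'M[R]_(F, T)) : 'M[R]_(ell n, T) :=
  sampling (local_samples Omega n) (submxcol Y n - L *m Q^T - submxcol Reg n *m B).

(** The normal equation is solved for the multiplier [O], the quantity to be bounded and averaged
    later. The [Z m] stand for the midpoints of neighboring iterates. *)
Lemma stationary_Q n L B ls O c (r : {pred 'I_N}) (Z : 'I_N -> 'M[R]_(T, rho)) X :
  is_minimizer (fun X : 'M[R]_(T, rho) =>
      local_residual Y Reg Omega L X B + ls * frobenius_norm X ^+ 2 + inner O X
      + c * \sum_(m in r) frobenius_norm (X - Z m) ^+ 2) X ->
  O = (residual (n := n) L X B)^T *m L - (2 * ls) *: X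
      - (2 * c) *: \sum_(m in r) (X - Z m).
Proof.
set G := (X in O = X) => /minimizer_stationary h.
apply/eqP; rewrite -subr_eq0; apply/eqP.
set D := O - G in h *.
(* [D] is the gradient at [X]; the witness is the coefficient of [t ^+ 2] in the expansion along
   [D]. *)
apply: (h D (2^-1 * frobenius_norm (sampling (local_samples Omega n) (L *m D^T)) ^+ 2
  + ls * frobenius_norm D ^+ 2 + c * \sum_(m in r) frobenius_norm D ^+ 2)) => t.
have -> : inner D D = inner O D - (inner ((residual L X B)^T *m L) D
    - 2 * ls * inner X D - 2 * c * inner (\sum_(m in r) (X - Z m)) D).
  by rewrite {1}/D /G !(innerBl, innerZl).
rewrite /local_residual.
have -> : submxcol Y n - L *m (X + t *: D)^T - submxcol Reg n *m B =
    submxcol Y n - L *m X^T - submxcol Reg n *m B - t *: (L *m D^T).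
  rewrite linearD linearZ mulmxDr -scalemxAr.
  by apply/matrixP => i j; rewrite !mxE; ring.
have -> : \sum_(m in r) frobenius_norm (X + t *: D - Z m) ^+ 2 =
    \sum_(m in r) frobenius_norm (X - Z m) ^+ 2
    + t * (2 * inner (\sum_(m in r) (X - Z m)) D)
    + t ^+ 2 * \sum_(m in r) frobenius_norm D ^+ 2.
  rewrite inner_suml !mulr_sumr -!big_split /=; apply: eq_bigr => m _.
  by rewrite (addrAC X) sqr_norm_expand.
rewrite half_sqr_sampling_expand sqr_norm_expand innerDr innerZr inner_mulmx_tr.
rewrite -/(residual L X B); ring.
Qed.

Lemma stationary_L n Q B ls X :
  is_minimizer (fun X : 'M[R]_(ell n, rho) =>
      local_residual Y Reg Omega X Q B + ls / 2 * frobenius_norm X ^+ 2) X ->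
  residual X Q B *m Q = ls *: X.
Proof.
move=> /minimizer_stationary h; apply/eqP; rewrite eq_sym -subr_eq0; apply/eqP.
set D := _ - _ in h *.
apply: (h D (2^-1 * frobenius_norm (sampling (local_samples Omega n) (D *m Q^T)) ^+ 2
  + ls / 2 * frobenius_norm D ^+ 2)) => t.
have -> : inner D D = ls * inner X D - inner (residual X Q B *m Q) D.
  by rewrite {1}/D innerBl innerZl.
rewrite /local_residual.
have -> : submxcol Y n - (X + t *: D) *m Q^T - submxcol Reg n *m B =
    submxcol Y n - X *m Q^T - submxcol Reg n *m B - t *: (D *m Q^T).
  rewrite mulmxDl -scalemxAl.
  by apply/matrixP => i j; rewrite !mxE; ring.
rewrite half_sqr_sampling_expand sqr_norm_expand inner_mulmxl trmxK.
by rewrite -/(residual X Q B); field.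
Qed.

Lemma stationary_B n (L : 'M[R]_(ell n, rho)) Q M A c X :
  is_minimizer (fun X : 'M[R]_(F, T) =>
      local_residual Y Reg Omega L Q X + inner M X
      + c / 2 * frobenius_norm (X - A) ^+ 2) X ->
  M = (submxcol Reg n)^T *m residual L Q X - c *: (X - A).
Proof.
set G := (X in M = X) => /minimizer_stationary h.
apply/eqP; rewrite -subr_eq0; apply/eqP.
set D := M - G in h *.
apply: (h D (2^-1 *
    frobenius_norm (sampling (local_samples Omega n) (submxcol Reg n *m D)) ^+ 2
  + c / 2 * frobenius_norm D ^+ 2)) => t.
have -> : inner D D = inner M D - (inner ((submxcol Reg n)^T *m residual L Q X) D
    - c * inner (X - A) D).
  by rewrite -innerZl -!innerBl.
rewrite /local_residual.
have -> : submxcol Y n - L *m Q^T - submxcol Reg n *m (X + t *: D) =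
    submxcol Y n - L *m Q^T - submxcol Reg n *m X - t *: (submxcol Reg n *m D).
  rewrite mulmxDr -scalemxAr.
  by apply/matrixP => i j; rewrite !mxE; ring.
rewrite (addrAC X) half_sqr_sampling_expand sqr_norm_expand innerDr innerZr.
by rewrite inner_mulmxr -/(residual L Q X); field.
Qed.

Lemma bounded_residual n L Q B :
  bounded_mx L -> bounded_mx Q -> bounded_mx B ->
  bounded_mx (fun k => residual (n := n) (L k) (Q k) (B k)).
Proof.
move=> bL bQ bB; apply: bounded_mx_sampling.
apply: bounded_mxB; last exact: bounded_mxM (bounded_mx_cst _) bB.
apply: bounded_mxB; first exact: bounded_mx_cst.
exact: bounded_mxM bL (bounded_mx_tr bQ).
Qed.

(** The residual is affine in [B], so a Cesaro mean is enough there, whereas [L] and [Q] enter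
    through their product and must converge. *)
Lemma mean_residual n L Q B l q b :
  cvg_mx L l -> cvg_mx Q q -> mean_mx B b ->
  mean_mx (fun k => residual (n := n) (L k) (Q k) (B k)) (residual l q b).
Proof.
move=> cL cQ mB; apply: mean_mx_sampling.
apply: mean_mxB; last exact: mean_mx_mull.
apply: mean_mx_cvg; apply: cvg_mxB; first exact: cvg_mx_cst.
exact: cvg_mxM cL (cvg_mx_tr cQ).
Qed.

End NormalEquations.

(** * Boundedness, averages and consensus along a run *)

Section DistributedRun.
(* Automatic implicits would unfold [cvg_mx] and hide the node index. *)
Local Unset Implicit Arguments.
Variables (R : realType) (N : nat) (adj : rel 'I_N).
Hypotheses (adj_sym : symmetric adj)
  (adj_connected : forall n m : 'I_N, connect adj n m).
Variables (ell : 'I_N -> nat) (T F rho : nat).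
Variables (Y : 'M[R]_(\sum_(n < N) ell n, T)) (Reg : 'M[R]_(\sum_(n < N) ell n, F)).
Variable Omega : {set 'I_(\sum_(n < N) ell n) * 'I_T}.
Variables lambda_star lambda_1 c mu : R.
Hypotheses (hlambda_1 : 0 <= lambda_1) (hc : 0 < c) (hmu : 0 < mu).
Variables (M P A B : nat -> 'I_N -> 'M[R]_(F, T)) (O Q : nat -> 'I_N -> 'M[R]_(T, rho)).
Variable L : nat -> forall n : 'I_N, 'M[R]_(ell n, rho).
Hypothesis run : is_distributed_run adj Y Reg Omega lambda_star lambda_1 c mu
  M P A B O Q L.
Variables (Qbar : 'I_N -> 'M[R]_(T, rho)) (Lbar : forall n : 'I_N, 'M[R]_(ell n, rho)).
Variable Abar : 'I_N -> 'M[R]_(F, T).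
Hypotheses (cvgQ : forall n, cvg_mx (fun k => Q k n) (Qbar n))
  (cvgL : forall n, cvg_mx (fun k => L k n) (Lbar n))
  (cvgA : forall n, cvg_mx (fun k => A k n) (Abar n)).

Local Notation res := (residual Y Reg Omega).
Let E k n := B k n - A k n.
Let kappa n : R := c * (1 + 2 * #|neighbors adj n|%:R).
Let V k n := M k n + c *: B k n - P k n
  + c *: \sum_(m in neighbors adj n) (A k n + A k m).
(** Hessian of the local data fit with respect to [B]. *)
Let H n (X : 'M[R]_(F, T)) : 'M[R]_(F, T) :=
  (submxcol Reg n)^T *m sampling (local_samples Omega n) (submxcol Reg n *m X).

(** The update rules hold from iteration 1 on, so current iterates are read at [k.+1] and updated
    ones at [k.+2]. *)
Let cvgQ1 n := cvg_mx_shift (cvgQ n).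
Let cvgQ2 n := cvg_mx_shift (cvgQ1 n).
Let cvgL1 n := cvg_mx_shift (cvgL n).
Let cvgL2 n := cvg_mx_shift (cvgL1 n).
Let cvgA1 n := cvg_mx_shift (cvgA n).
Let cvgA2 n := cvg_mx_shift (cvgA1 n).

Let kappa0 n : 0 < kappa n.
Proof. by rewrite mulr_gt0 // ltr_wpDr // mulr_ge0. Qed.

Let tau0 : 0 <= lambda_1 / N%:R.
Proof. by rewrite divr_ge0. Qed.

Let AE k n : A k.+2 n = (kappa n)^-1 *: soft_threshold (lambda_1 / N%:R) (V k.+1 n).
Proof. exact: (run_A run). Qed.

Let bounded_V n : bounded_mx (fun k => V k.+1 n).
Proof.
apply: (bounded_mx_soft_threshold tau0 (kappa0 n) (fun k => AE k n)).
exact: cvg_bounded_mx (cvgA2 n).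
Qed.

Let H_lin n : {morph H n : X Z / X + Z} /\ forall a, {morph H n : X / a *: X}.
Proof.
split=> [X Z|a X]; rewrite /H; first by rewrite mulmxDr samplingD mulmxDr.
by rewrite -scalemxAr samplingZ -scalemxAr.
Qed.

Let bounded_H n X : bounded_mx X -> bounded_mx (fun k => H n (X k)).
Proof.
move=> bX; apply: bounded_mxM; first exact: bounded_mx_cst.
by apply: bounded_mx_sampling; apply: bounded_mxM bX; exact: bounded_mx_cst.
Qed.

Let stepM k n : M k.+1 n = M k n + mu *: E k.+1 n.
Proof. exact: (run_M run). Qed.

Let stepP k n : P k.+1 n = P k n + mu *: \sum_(m in neighbors adj n) (A k.+1 n - A k.+1 m).
Proof. exact: (run_P run). Qed.

Let stepO k n : O k.+1 n = O k n + mu *: \sum_(m in neighbors adj n) (Q k.+1 n - Q k.+1 m).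
Proof. exact: (run_O run). Qed.

(** Writing [B] as [A + E] in the residual moves the unknown behaviour of [B] into [H], and leaves
    on the right only sequences assumed to converge. *)
Let statE k n : H n (E k.+2 n) + M k.+1 n + c *: E k.+2 n =
  (submxcol Reg n)^T *m res (L k.+2 n) (Q k.+2 n) (A k.+2 n).
Proof.
rewrite (stationary_B (run_B run n (isT : 1 <= k.+1)%N)) -/(E _ n) -addrA subrK.
rewrite /H -mulmxDr; congr (_ *m _).
rewrite /residual /E mulmxBr -samplingD; congr sampling.
by apply/matrixP => i j; rewrite !mxE; ring.
Qed.

Let dP_cvg n : cvg_mx (fun k => P k.+2 n - P k.+1 n)
  (mu *: \sum_(m in neighbors adj n) (Abar n - Abar m)).
Proof.
under eq_fun do rewrite stepP addrC addKr.
apply: cvg_mxZ; apply: cvg_mx_sum => m _; exact: cvg_mxB (cvgA2 n) (cvgA2 m).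
Qed.

Let dO_cvg n : cvg_mx (fun k => O k.+2 n - O k.+1 n)
  (mu *: \sum_(m in neighbors adj n) (Qbar n - Qbar m)).
Proof.
under eq_fun do rewrite stepO addrC addKr.
apply: cvg_mxZ; apply: cvg_mx_sum => m _; exact: cvg_mxB (cvgQ2 n) (cvgQ2 m).
Qed.

Lemma multipliers_bounded n : [/\ bounded_mx (fun k => P k.+1 n),
  bounded_mx (fun k => E k.+1 n) & bounded_mx (fun k => M k.+1 n)].
Proof.
have [HD HZ] := H_lin n.
(* The role of [U] is played by [V] stripped of its terms in [A], which is [M + c E - P]; it is
   bounded because [V] and the [A] are. *)
apply: (@multiplier_bound R F T (H n) c mu HD HZ (@bounded_H n) hc hmu
  (fun k => E k.+1 n) (fun k => M k.+1 n) (fun k => P k.+1 n)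
  (fun k => (submxcol Reg n)^T *m res (L k.+2 n) (Q k.+2 n) (A k.+2 n))
  (fun k => V k.+1 n - c *: A k.+1 n
     - c *: \sum_(m in neighbors adj n) (A k.+1 n + A k.+1 m))) => //.
- apply: bounded_mxM; first exact: bounded_mx_cst.
  by apply: bounded_residual; apply: cvg_bounded_mx;
    [exact: cvgL2 | exact: cvgQ2 | exact: cvgA2].
- have bA m : bounded_mx (fun k => A k.+1 m) := cvg_bounded_mx (cvgA1 m).
  apply: bounded_mxB; first by apply: bounded_mxB => //; exact: bounded_mxZ.
  by apply: bounded_mxZ; apply: bounded_mx_sum => m _; exact: bounded_mxD.
- exact: cvg_bounded_mx (dP_cvg n).
- move=> k; rewrite /V /E; set S := \sum_(m in _) _.
  by apply/matrixP => i j; rewrite !mxE; ring.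
Qed.

Lemma bounded_B n : bounded_mx (fun k => B k.+1 n).
Proof.
have [_ bE _] := multipliers_bounded n.
have -> : (fun k => B k.+1 n) = (fun k => E k.+1 n + A k.+1 n).
  by apply/funext => k; rewrite subrK.
by apply: bounded_mxD => //; exact: cvg_bounded_mx (cvgA1 n).
Qed.

(** Up to the factor [mu], [E] is the increment of the bounded sequence [M]. *)
Lemma mean_E n : mean_mx (fun k => E k.+1 n) 0.
Proof.
have [_ _ bM1] := multipliers_bounded n.
have bM := @bounded_mx_shift _ _ _ (M^~ n) bM1.
have := mean_mxZ (a := mu^-1) (mean_mx_increments bM); rewrite scaler0.
congr mean_mx; apply/funext => k.
by rewrite stepM addrC addKr scalerK // lt0r_neq0.
Qed.

Lemma mean_E1 n : mean_mx (fun k => E k.+2 n) 0.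
Proof.
have [_ _ bM] := multipliers_bounded n.
have := mean_mxZ (a := mu^-1) (mean_mx_increments bM); rewrite scaler0.
congr mean_mx; apply/funext => k.
by rewrite stepM addrC addKr scalerK // lt0r_neq0.
Qed.

Lemma mean_B n : mean_mx (fun k => B k.+1 n) (Abar n).
Proof.
have := mean_mxD (mean_E n) (mean_mx_cvg (cvgA1 n)); rewrite add0r.
by congr mean_mx; apply/funext => k; rewrite subrK.
Qed.

Let OE k n : O k.+1 n = (res (L k.+1 n) (Q k.+2 n) (B k.+1 n))^T *m L k.+1 n
  - (lambda_star / N%:R) *: Q k.+2 n
  - (2 * c) *: \sum_(m in neighbors adj n) (Q k.+2 n - 2^-1 *: (Q k.+1 n + Q k.+1 m)).
Proof.
rewrite (stationary_Q (run_Q run n (isT : 1 <= k.+1)%N)).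
(* If [N%:R] were 0, both coefficients would be 0 by the convention on the inverse of 0; otherwise
   [field] applies. *)
congr (_ - _ *: _ - _); have [n0|n0] := eqVneq (N%:R : R) 0.
  by rewrite n0 mulr0 invr0 !mulr0.
by field.
Qed.

(** Convergence alone serves to bound [O]; the limit turns out to be 0 once consensus of the [Qbar]
    is known. *)
Let tailQ n : cvg_mx
  (fun k => (2 * c) *: \sum_(m in neighbors adj n) (Q k.+2 n - 2^-1 *: (Q k.+1 n + Q k.+1 m)))
  ((2 * c) *: \sum_(m in neighbors adj n) (Qbar n - 2^-1 *: (Qbar n + Qbar m))).
Proof.
apply: cvg_mxZ; apply: cvg_mx_sum => m _; apply: cvg_mxB (cvgQ2 n) _.
by apply: cvg_mxZ; apply: cvg_mxD; exact: cvgQ1.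
Qed.

Lemma bounded_O n : bounded_mx (fun k => O k.+1 n).
Proof.
under eq_fun do rewrite OE; apply: bounded_mxB; last exact: cvg_bounded_mx (tailQ n).
have bQ := cvg_bounded_mx (cvgQ2 n); have bL := cvg_bounded_mx (cvgL1 n).
apply: bounded_mxB; last exact: bounded_mxZ.
apply: (bounded_mxM _ bL); apply: bounded_mx_tr; apply: bounded_residual => //.
exact: bounded_B.
Qed.

Let consensus_mx m n (X : 'I_N -> 'M[R]_(m, n)) (Z : nat -> 'I_N -> 'M[R]_(m, n)) :
  (forall i, bounded_mx (fun k => Z k i)) ->
  (forall i, cvg_mx (fun k => Z k.+1 i - Z k i)
     (mu *: \sum_(j in neighbors adj i) (X i - X j))) ->
  forall i j, X i = X j.
Proof.
move=> bZ dZ i j; apply/matrixP => a b.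
apply: (@consensus _ _ adj_sym _ (fun i => X i a b)) => // l.
have /matrixP/(_ a b) := mean_mx_unique (mean_mx_cvg (dZ l)) (mean_mx_increments (bZ l)).
rewrite !mxE summxE => /eqP; rewrite mulf_eq0 gt_eqF //= => /eqP h.
by rewrite -[RHS]h; apply: eq_bigr => p _; rewrite !mxE.
Qed.

Lemma consensus_A n m : Abar n = Abar m.
Proof.
apply: (consensus_mx _ _ _ (fun k n => P k.+1 n)) => // i.
by have [] := multipliers_bounded i.
Qed.

Lemma consensus_Q n m : Qbar n = Qbar m.
Proof. apply: (consensus_mx _ _ _ (fun k n => O k.+1 n)) => //; exact: bounded_O. Qed.

(** * Optimality conditions at the limit point *)

Let S n := res (Lbar n) (Qbar n) (Abar n).

(** The residual involves [B] and has a limit only in mean, but its partner [Q] converges, so the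
    mean of the product is the product of the limits. *)
Lemma limit_L n : S n *m Qbar n = lambda_star *: Lbar n.
Proof.
have bS : bounded_mx (fun k => res (L k.+2 n) (Q k.+2 n) (B k.+1 n)).
  by apply: bounded_residual; [exact: cvg_bounded_mx (cvgL2 n)
    | exact: cvg_bounded_mx (cvgQ2 n) | exact: bounded_B].
have mS := mean_mxM bS (mean_residual (cvgL2 n) (cvgQ2 n) (mean_B n)) (cvgQ2 n).
apply: mean_mx_unique mS _.
have := mean_mx_cvg (cvg_mxZ (a := lambda_star) (cvgL2 n)).
congr mean_mx; apply/funext => k.
by rewrite -(stationary_L (run_L run (n := n) (isT : 1 <= k.+1)%N)).
Qed.

Let sum_O k : \sum_n O k n = 0.
Proof.
elim: k => [|k IH]; first by rewrite big1 // => n _; exact: (run_O0 run).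
under eq_bigr do rewrite stepO.
by rewrite big_split /= IH add0r -scaler_sumr sum_neighbors_sub // scaler0.
Qed.

Let sum_P k : \sum_n P k n = 0.
Proof.
elim: k => [|k IH]; first by rewrite big1 // => n _; exact: (run_P0 run).
under eq_bigr do rewrite stepP.
by rewrite big_split /= IH add0r -scaler_sumr sum_neighbors_sub // scaler0.
Qed.

(** Each local equation still contains the mean of [O n]; only the sum over nodes, where the
    multipliers cancel, is free of it. *)
Lemma limit_Q : \sum_n (S n)^T *m Lbar n = \sum_n (lambda_star / N%:R) *: Qbar n.
Proof.
have mO n : mean_mx (fun k => O k.+1 n)
    ((S n)^T *m Lbar n - (lambda_star / N%:R) *: Qbar n).
  rewrite (funext (fun k => OE k n)) -[X in mean_mx _ X]subr0; apply: mean_mxB.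
    apply: mean_mxB; last exact: mean_mx_cvg (cvg_mxZ (cvgQ2 n)).
    apply: mean_mxM (cvgL1 n).
      apply: bounded_mx_tr; apply: bounded_residual; [exact: cvg_bounded_mx (cvgL1 n)
        | exact: cvg_bounded_mx (cvgQ2 n) | exact: bounded_B].
    by apply: mean_mx_tr; apply: mean_residual; [exact: cvgL1 | exact: cvgQ2 | exact: mean_B].
  have := mean_mx_cvg (tailQ n); rewrite big1 ?scaler0 // => m _.
  by rewrite (consensus_Q m n); apply/matrixP => i j; rewrite !mxE; field.
apply/eqP; rewrite -subr_eq0 -sumrB; apply/eqP.
apply: mean_mx_unique (mean_mx_sum (fun n _ => mO n)) _.
rewrite (funext (fun k => sum_O k.+1)); exact: mean_mx_cvg (@cvg_mx_cst _ _ _ _).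
Qed.

(** Subgradient of [lambda_1 / N] times the entrywise norm at [A k.+2 n], as supplied by
    soft-thresholding. *)
Let W k n := V k.+1 n - kappa n *: A k.+2 n.

Let tail k n := c *: A k.+1 n + c *: (\sum_(m in neighbors adj n) (A k.+1 n + A k.+1 m))
  - kappa n *: A k.+2 n.

(** By consensus the first two terms tend to [c + 2 c |J_n|], that is [kappa n], times the common
    limit, which the last term removes. *)
Let tail_cvg n : cvg_mx (fun k => tail k n) 0.
Proof.
have -> : 0 = c *: Abar n + c *: (\sum_(m in neighbors adj n) (Abar n + Abar m))
    - kappa n *: Abar n.
  under eq_bigr => m _ do rewrite (consensus_A m n).
  by rewrite sumr_const; apply/matrixP => i j; rewrite !mxE mulmxnE !mxE /kappa; ring.
apply: cvg_mxB; last by apply: cvg_mxZ; exact: cvgA2.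
apply: cvg_mxD; apply: cvg_mxZ => //; apply: cvg_mx_sum => m _.
by apply: cvg_mxD; exact: cvgA1.
Qed.

(** In [statE] the terms in [E] are linear and average to 0. *)
Let mean_M n : mean_mx (fun k => M k.+1 n) ((submxcol Reg n)^T *m S n).
Proof.
have -> : (fun k => M k.+1 n) =
    (fun k => (submxcol Reg n)^T *m res (L k.+2 n) (Q k.+2 n) (A k.+2 n)
      - H n (E k.+2 n) - c *: E k.+2 n).
  by apply/funext => k; rewrite -statE; apply/matrixP => i j; rewrite !mxE; ring.
rewrite -[X in mean_mx _ X]subr0 -[X in mean_mx _ (X - _)]subr0; apply: mean_mxB.
  apply: mean_mxB.
    apply: mean_mx_mull; apply: mean_residual; [exact: cvgL2 | exact: cvgQ2 |].
    exact: mean_mx_cvg (cvgA2 n).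
  have H0 : H n 0 = 0 by have := (H_lin n).2 0 0; rewrite !scale0r.
  rewrite -[X in mean_mx _ X]H0.
  by apply: mean_mx_mull; apply: mean_mx_sampling; apply: mean_mx_mull; exact: mean_E1.
by rewrite -(scaler0 _ c); apply: mean_mxZ; exact: mean_E1.
Qed.

Let WE k n : W k n = M k.+1 n + c *: E k.+1 n + tail k n - P k.+1 n.
Proof.
rewrite /W /V /E /tail; set Sg := \sum_(m in _) _.
by apply/matrixP => i j; rewrite !mxE; ring.
Qed.

Let mean_W : mean_mx (fun k => \sum_n W k n) (\sum_n (submxcol Reg n)^T *m S n).
Proof.
have -> : (fun k => \sum_n W k n) =
    (fun k => \sum_n (M k.+1 n + c *: E k.+1 n + tail k n)).
  by apply/funext => k; under eq_bigr do rewrite WE; rewrite sumrB sum_P subr0.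
apply: mean_mx_sum => n _; rewrite -[X in mean_mx _ X]addr0; apply: mean_mxD.
  rewrite -[X in mean_mx _ X]addr0; apply: mean_mxD; first exact: mean_M.
  by rewrite -(scaler0 _ c); apply: mean_mxZ; exact: mean_E.
exact: mean_mx_cvg (tail_cvg n).
Qed.

Let bounded_W n : bounded_mx (fun k => W k n).
Proof.
by apply: bounded_mxB; [exact: bounded_V | apply/bounded_mxZ/cvg_bounded_mx/cvgA2].
Qed.

Lemma limit_A (n1 : 'I_N) Z :
  inner (\sum_n (submxcol Reg n)^T *m S n) (Z - Abar n1) <=
  lambda_1 * (l1_norm Z - l1_norm (Abar n1)).
Proof.
(* [f k] is the sum over nodes of the subgradient inequalities at [A k.+2 n]. The direction is split
   into a fixed part, paired with the sum of the [W] whose mean is known, and a part tending to 0,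
   paired with each bounded [W]. *)
pose f k := inner (\sum_n W k n) (Z - Abar n1)
  + \sum_n (inner (W k n) (Abar n - A k.+2 n)
    - lambda_1 / N%:R * (l1_norm Z - l1_norm (A k.+2 n))).
have f0 k : f k <= 0.
  rewrite /f inner_suml -big_split; apply: sumr_le0 => n _ /=.
  rewrite (consensus_A n1 n) addrA -innerDr addrA subrK subr_le0.
  exact: soft_threshold_subgradient.
have mf : mean_to f (inner (\sum_n (submxcol Reg n)^T *m S n) (Z - Abar n1)
  + \sum_n (0 - lambda_1 / N%:R * (l1_norm Z - l1_norm (Abar n)))).
  apply: mean_toD.
    apply: mean_inner mean_W (@cvg_mx_cst _ _ _ _); apply: bounded_mx_sum => n _.
    exact: bounded_W.
  apply: mean_to_sum => n _; apply: mean_toD.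
    apply: mean_inner0; first exact: bounded_W.
    by rewrite -(subrr (Abar n)); apply: cvg_mxB; [exact: cvg_mx_cst | exact: cvgA2].
  apply: mean_toN; apply: mean_toZ; apply: mean_toD; first exact: mean_to_cst.
  by apply: mean_toN; exact: mean_l1_norm.
have := mean_to_le0 mf f0; set w := inner _ _.
under eq_bigr => n _ do rewrite (consensus_A n n1) sub0r.
(* The [N] equal shares [lambda_1 / N] add up to [lambda_1]; the node [n1] witnesses that [N] is
   positive. *)
rewrite sumrN subr_le0 sumr_const card_ord -[_ *+ N]mulr_natl mulrA mulrCA divff ?mulr1 //.
by rewrite pnatr_eq0 -lt0n (leq_ltn_trans _ (ltn_ord n1)).
Qed.

Local Set Implicit Arguments.

(** The node conditions are stacked to meet [P1_certificate]: transposed products of stacks are sums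
    over nodes, matching [limit_Q] and [limit_A], while [limit_L] is used block by block. *)
Lemma limit_consensus_optimal (n1 : 'I_N) :
  let Xhat := (\mxcol_n Lbar n) *m (Qbar n1)^T in
  let Ahat := Abar n1 in
  0 <= lambda_star ->
  (forall n m, Qbar n = Qbar m /\ Abar n = Abar m) /\
  (spectral_norm (sampling Omega (Y - Xhat - Reg *m Ahat)) <= lambda_star ->
   is_minimizer (P1_objective Y Reg Omega lambda_star lambda_1) (Xhat, Ahat)).
Proof.
move=> Xhat Ahat hlambda_star.
split=> [n m|]; first by split; [exact: consensus_Q | exact: consensus_A].
have SE : sampling Omega (Y - Xhat - Reg *m Ahat) = \mxcol_n S n.
  rewrite -sampling_mxcol -[Y in LHS]submxcolK -[Reg in LHS]submxcolK.
  rewrite /Xhat !mxcol_mul -!mxcolB; congr sampling.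
  by apply/eq_mxcol => n; rewrite (consensus_Q n n1) (consensus_A n n1).
have N0 : (N%:R : R) != 0.
  by rewrite pnatr_eq0 -lt0n (leq_ltn_trans _ (ltn_ord n1)).
have SL : (\mxcol_n S n)^T *m (\mxcol_n Lbar n) = lambda_star *: Qbar n1.
  rewrite tr_mxcol mul_mxrow_mxcol limit_Q.
  under eq_bigr => n _ do rewrite (consensus_Q n n1).
  by rewrite sumr_const card_ord -scaler_nat scalerA mulrCA divff // mulr1.
have SQ : (\mxcol_n S n) *m Qbar n1 = lambda_star *: \mxcol_n Lbar n.
  rewrite mxcol_mul; apply/mxcolP => n; rewrite mxcolK -(consensus_Q n n1) limit_L.
  by apply/matrixP => i j; have /matrixP/(_ i j) := mxcolK Lbar n; rewrite !mxE => ->.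
move=> Sl; apply: P1_certificate => //; rewrite -/Xhat -/Ahat SE // => Z.
rewrite -[Reg in X in inner X]submxcolK tr_mxcol mul_mxrow_mxcol.
exact: limit_A.
Qed.

End DistributedRun.

Theorem proposition2 (R : realType) (N : nat) (hN : (1 <= N)%N)
    (adj : rel 'I_N) (adj_sym : symmetric adj) (adj_irr : irreflexive adj)
    (adj_connected : forall n m : 'I_N, connect adj n m)
    (ell : 'I_N -> nat) (T F rho : nat)
    (hL : (0 < \sum_(n < N) ell n)%N) (hT : (0 < T)%N) (hF : (0 < F)%N)
    (hrho : (1 <= rho)%N)
    (Y : 'M[R]_(\sum_(n < N) ell n, T)) (Reg : 'M[R]_(\sum_(n < N) ell n, F))
    (Omega : {set 'I_(\sum_(n < N) ell n) * 'I_T})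
    (lambda_star lambda_1 c mu : R)
    (hlambda_star : 0 <= lambda_star) (hlambda_1 : 0 <= lambda_1)
    (hc : 0 < c) (hmu : 0 < mu)
    (M P A B : nat -> 'I_N -> 'M[R]_(F, T))
    (O Q : nat -> 'I_N -> 'M[R]_(T, rho))
    (L : nat -> forall n : 'I_N, 'M[R]_(ell n, rho))
    (run : is_distributed_run adj Y Reg Omega lambda_star lambda_1 c mu
             M P A B O Q L)
    (Qbar : 'I_N -> 'M[R]_(T, rho))
    (Lbar : forall n : 'I_N, 'M[R]_(ell n, rho))
    (Abar : 'I_N -> 'M[R]_(F, T))
    (cvgQ : forall n : 'I_N, (fun k : nat => Q k n) @ \oo --> Qbar n)
    (cvgL : forall n : 'I_N, (fun k : nat => L k n) @ \oo --> Lbar n)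
    (cvgA : forall n : 'I_N, (fun k : nat => A k n) @ \oo --> Abar n) :
  (forall n m : 'I_N, Qbar n = Qbar m /\ Abar n = Abar m) /\
  (let n1 : 'I_N := Ordinal hN in
   let Xhat := (\mxcol_n Lbar n) *m (Qbar n1)^T in
   let Ahat := Abar n1 in
   spectral_norm (sampling Omega (Y - Xhat - Reg *m Ahat)) <= lambda_star ->
   is_minimizer (P1_objective Y Reg Omega lambda_star lambda_1) (Xhat, Ahat)).
Proof.
exact: (limit_consensus_optimal adj_sym adj_connected hlambda_1 hc hmu run
  (fun n => cvg_to_cvg_mx (cvgQ n)) (fun n => cvg_to_cvg_mx (cvgL n))
  (fun n => cvg_to_cvg_mx (cvgA n)) _ hlambda_star).
Qed.
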